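(* Let $\mathcal{L}(Y)=\mathcal{L}((Y_t)_{t\in[0,1]})=\nu$ and $\mathcal{L}(X)=\mathcal{L}((X_t)_{t\in[0,1]})=\mu$ be probability measures on $\mathcal{C}[0,1]$. (i) For $0<s\le1$ we have $\mu\in\mathcal{M}_s(\nu)$ if $$\mathbf{E}[\|X\|_\infty^s],\ \mathbf{E}[\|Y\|_\infty^s]<\infty.\qquad( * )$$ (ii) For $1<s\le2$ we have $\mu\in\mathcal{M}_s(\nu)$ if $( * )$ holds and $$\mathbf{E}[X_t]=\mathbf{E}[Y_t]\quad\text{for all }0\le t\le1.\qquad( ** )$$ (iii) For $2<s\le3$ we have $\mu\in\mathcal{M}_s(\nu)$ if $( * )$ and $( ** )$ hold and $$\operatorname{Cov}(X_t,X_u)=\operatorname{Cov}(Y_t,Y_u)\quad\text{for all }0\le t,u\le1.$$ The assertions remain true if $\mathcal{C}[0,1]$ is replaced by $\mathcal{D}[0,1]$.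
   Context: $\mathcal{C}[0,1]$ is the space of continuous functions $[0,1]\to\mathbb{R}$ with the sup norm $\|\cdot\|_\infty$ and its Borel $\sigma$-algebra. $\mathcal{D}[0,1]$ is the space of càdlàg functions with the Borel $\sigma$-algebra of the Skorokhod metric. For $B=\mathcal{C}[0,1]$ or $\mathcal{D}[0,1]$ and $s>0$, $\mathcal{M}_s(B)$ is the set of probability measures $\mu$ on $B$ with $\int\|x\|_\infty^s\,d\mu(x)<\infty$; for $\nu\in\mathcal{M}_s(B)$, $\mathcal{M}_s(\nu)$ is the set of $\mu\in\mathcal{M}_s(B)$ such that $$\int f(x,\dots,x)\,d\mu(x)=\int f(x,\dots,x)\,d\nu(x)$$ for every $k$-linear form $f$ on $B$ that is bounded with respect to $\|\cdot\|_\infty$ and every $1\le k\le m:=\lceil s\rceil-1$ (no condition if $m=0$). *)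

(* Defs.v *)
From HB Require Import structures.
From mathcomp Require Import all_boot all_order all_algebra.
From mathcomp Require Import all_classical all_reals all_analysis.
From mathcomp Require Import lra.
Set Implicit Arguments.
Unset Strict Implicit.
Unset Printing Implicit Defensive.
Import Order.TTheory GRing.Theory Num.Theory.
Import numFieldNormedType.Exports.
Local Open Scope classical_set_scope.
Local Open Scope ring_scope.

Notation I01 R := (set_type `[0 : R, 1]%classic).

Section paths.
Context {R : realType}.
Implicit Types x y z : I01 R -> R.

(* At t = 0 the left filter is improper, so the left-limit clause is void there;
   at t = 1 the right-continuity clause is void. *)
Definition cadlag x := forall t : I01 R,
  x u @[u --> within [set u | \val t <= \val u] (nbhs t)] --> x t /\
  exists l : R, x u @[u --> within [set u | \val u < \val t] (nbhs t)] --> l.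

(* A genuine supremum on the two path spaces, whose elements are bounded
   (cadlag_bounded). *)
Definition supnorm x : R := sup (range (fun t => `|x t|)).

Definition bounded_path x := exists M : R, forall t, `|x t| <= M.

Lemma nbhs_I01P (t : I01 R) (A : set (I01 R)) :
  nbhs t A <-> exists2 e : R, 0 < e & forall u, `|\val t - \val u| < e -> A u.
Proof.
split.
- move=> /nbhs_ballP[e /= e0 h]; by exists e => // u ut; apply: h.
- move=> [e e0 h]; by apply/nbhs_ballP; exists e => //= u ut; exact: h.
Qed.

Lemma within_I01P (t : I01 R) (D : set (I01 R)) x (l : R) :
  x u @[u --> within D (nbhs t)] --> l <->
  forall e : R, 0 < e -> exists2 d : R, 0 < d &
    forall u, D u -> `|\val t - \val u| < d -> `|l - x u| < e.
Proof.
split.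
- move=> /cvgrPdist_lt h e e0; have /nbhs_I01P[d d0 hd] := h e e0.
  by exists d => // u Du ut; exact: hd.
- move=> h; apply/cvgrPdist_lt => e e0; have [d d0 hd] := h e e0.
  by apply/nbhs_I01P; exists d => // u ut Du; exact: hd.
Qed.

Lemma cadlag_right x (t : I01 R) : cadlag x -> forall e : R, 0 < e ->
  exists2 d : R, 0 < d & forall u, \val t <= \val u -> `|\val t - \val u| < d ->
    `|x t - x u| < e.
Proof. by move=> /(_ t)[/within_I01P]. Qed.

Lemma cadlag_bounded x : cadlag x -> bounded_path x.
Proof.
move=> cx.
have K : near_covering `[0 : R, 1]%classic.
  by apply/compact_near_coveringP; exact: segment_compact.
pose P (M : R) (t : R) := forall u : I01 R, \val u = t -> `|x u| <= M.
have loc (t : R) : `[0 : R, 1]%classic t ->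
    \forall t' \near t & M \near +oo, P M t'.
  move=> t01; pose t0 : I01 R := exist _ t (mem_set t01).
  have [d1 d10 h1] := cadlag_right t0 cx ltr01.
  have [_ [l /within_I01P/(_ 1 ltr01)[d2 d20 h2]]] := cx t0.
  pose B := Num.max (`|x t0| + 1) (`|l| + 1).
  exists (ball t (Num.min d1 d2), [set M | B < M]).
    split => /=; first by apply: nbhsx_ballx; rewrite lt_min d10.
    exact: nbhs_pinfty_gt (num_real _).
  move=> [t' M] /= [tt' BM] u ut'; apply: le_trans (ltW BM).
  move: tt'; rewrite /ball /= -ut' lt_min => /andP[u1 u2].
  have tri (a : R) : `|a - x u| < 1 -> `|x u| <= `|a| + 1.
    move=> h; have -> : x u = a - (a - x u) by lra.
    by rewrite (le_trans (ler_normB _ _))// lerD2l ltW.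
  have [tu|ut] := leP t (\val u).
    by rewrite le_max tri//; exact: h1.
  by rewrite le_max (tri l) ?orbT//; exact: h2.
have [N [_ hN]] := K R +oo P _ loc.
exists (N + 1) => t; apply: (hN (N + 1)) => //; first by rewrite ltrDl.
exact: set_valP.
Qed.

Lemma continuous_cadlag x : continuous x -> cadlag x.
Proof.
move=> cx t; split; last exists (x t);
  exact: cvg_within_filter (cx t).
Qed.

Lemma I01_0 : (`[0 : R, 1]%classic) 0.
Proof. by rewrite /= in_itv /= lexx ler01. Qed.
Definition zero01 : I01 R := exist _ 0 (mem_set I01_0).

Lemma supnorm_ub x t : bounded_path x -> `|x t| <= supnorm x.
Proof.
move=> [M hM]; apply: ub_le_sup; last by exists t.
by exists M => _ [u _ <-].
Qed.

Lemma supnorm_le x (M : R) : (forall t, `|x t| <= M) -> supnorm x <= M.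
Proof.
move=> h; apply: ge_sup; first by exists `|x zero01|; exists zero01.
by move=> _ [u _ <-].
Qed.

Lemma supnorm_ge0 x : bounded_path x -> 0 <= supnorm x.
Proof. by move=> b; exact: le_trans (supnorm_ub zero01 b). Qed.

End paths.

(* The Borel sigma-algebra of a vector space with a topology, not assumed to be
   compatible with the linear structure (the Skorokhod topology is not). *)
Section borel.
Variables (R : numDomainType) (B : preTopologicalLmodType R).
Definition borel : Type := B.
HB.instance Definition _ := Choice.on borel.
HB.instance Definition _ := isPointed.Build borel (0 : B).
HB.instance Definition _ :=
  Measurable.copy borel (@g_sigma_algebraType borel (@open B)).
End borel.

Section path_types.
Variable R : realType.

Definition continuous_pred : {pred I01 R -> R} :=
  mem [set x : I01 R -> R | continuous x].
Definition cadlag_pred : {pred I01 R -> R} :=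
  mem [set x : I01 R -> R | cadlag x].

Record C01 := ContinuousPath {
  continuous_path :> I01 R -> R ; _ : continuous_path \in continuous_pred }.
Record D01 := CadlagPath {
  cadlag_path :> I01 R -> R ; _ : cadlag_path \in cadlag_pred }.

Lemma C01_continuous (x : C01) : continuous x.
Proof. by case: x => x /= /set_mem. Qed.

Lemma D01_cadlag (x : D01) : cadlag x.
Proof. by case: x => x /= /set_mem. Qed.

Lemma C01_bounded (x : C01) : bounded_path x.
Proof. exact/cadlag_bounded/continuous_cadlag/C01_continuous. Qed.

Lemma D01_bounded (x : D01) : bounded_path x.
Proof. exact/cadlag_bounded/D01_cadlag. Qed.

Lemma continuous_submod : submod_closed continuous_pred.
Proof.
split; first by apply/mem_set; exact: cst_continuous.
move=> a x y /set_mem cx /set_mem cy; apply/mem_set => t.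
exact: cvgD (cvgZl_tmp (cx t)) (cy t).
Qed.

Lemma cadlag_submod : submod_closed cadlag_pred.
Proof.
split.
  apply/mem_set => t; split; last exists 0; apply/within_I01P => e e0;
    by exists 1 => // u _ _; rewrite subrr normr0.
move=> a x y /set_mem cx /set_mem cy; apply/mem_set => t.
have [x1 [l x2]] := cx t; have [y1 [m y2]] := cy t.
split; first exact: cvgD (cvgZl_tmp x1) y1.
by exists (a *: (l : R^o) + m); exact: cvgD (cvgZl_tmp x2) y2.
Qed.

HB.instance Definition _ :=
  GRing.isSubmodClosed.Build _ _ continuous_pred continuous_submod.
HB.instance Definition _ :=
  GRing.isSubmodClosed.Build _ _ cadlag_pred cadlag_submod.

HB.instance Definition _ := [isSub for continuous_path].
HB.instance Definition _ := [Choice of C01 by <:].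
HB.instance Definition _ := [SubChoice_isSubLmodule of C01 by <:].
HB.instance Definition _ := [isSub for cadlag_path].
HB.instance Definition _ := [Choice of D01 by <:].
HB.instance Definition _ := [SubChoice_isSubLmodule of D01 by <:].

Lemma C01_normD (x y : C01) : supnorm (x + y) <= supnorm x + supnorm y.
Proof.
apply: supnorm_le => t; apply: le_trans (ler_normD _ _) _.
by apply: lerD; apply: supnorm_ub; exact: C01_bounded.
Qed.

Lemma C01_normZ (a : R) (x : C01) : supnorm (a *: x) = `|a| * supnorm x.
Proof.
have le (b : R) (y : C01) : supnorm (b *: y) <= `|b| * supnorm y.
  apply: supnorm_le => t; rewrite -[X in X <= _]/(`|b * y t|) normrM.
  by apply: ler_wpM2l => //; exact/supnorm_ub/C01_bounded.
have [->|a0] := eqVneq a 0.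
  rewrite normr0 mul0r; apply/eqP; rewrite eq_le; apply/andP; split.
    by apply: supnorm_le => t; rewrite -[X in X <= _]/(`|0 * x t|) mul0r normr0.
  exact/supnorm_ge0/C01_bounded.
apply/eqP; rewrite eq_le le /=.
rewrite -ler_pdivlMl ?normr_gt0// -normfV.
by have := le a^-1 (a *: x); rewrite scalerA mulVf// scale1r.
Qed.

Lemma C01_norm0 (x : C01) : supnorm x = 0 -> x = 0.
Proof.
move=> x0; apply/val_inj/funext => t; apply/eqP.
by rewrite -normr_le0; have := supnorm_ub t (C01_bounded x); rewrite x0.
Qed.

HB.instance Definition _ :=
  Lmodule_isNormed.Build R C01 C01_normD C01_normZ C01_norm0.

(* An increasing surjection of [0, 1] is automatically a homeomorphism. *)
Definition time_change (lam : I01 R -> I01 R) :=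
  {homo lam : t u / \val t < \val u} /\ (forall u, exists t, lam t = u).

Definition skorokhod_close (x y : I01 R -> R) (e : R) :=
  exists2 lam, time_change lam & forall t,
    `|\val (lam t) - \val t| <= e /\ `|x t - y (lam t)| <= e.

(* inf over time changes lam of max(|lam - id|, |x - y o lam|), suprema over
   [0, 1]. It induces the topology of D01, while supnorm provides the norm used
   for moments and for boundedness of forms. *)
Definition skorokhod_dist (x y : D01) : R :=
  inf [set e | 0 < e /\ skorokhod_close x y e].

Lemma skorokhod_ex (x y : D01) : [set e | 0 < e /\ skorokhod_close x y e] !=set0.
Proof.
have [M hM] := D01_bounded x; have [N hN] := D01_bounded y.
have M0 := le_trans (normr_ge0 _) (hM zero01).
have N0 := le_trans (normr_ge0 _) (hN zero01).
exists (M + N + 1); split; first by lra.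
exists id => [|t]; first by split => // u; exists u.
split; first by rewrite subrr normr0; lra.
rewrite (le_trans (ler_normB _ _))//; have := hM t; have := hN t; lra.
Qed.

Lemma skorokhod_lb (x y : D01) :
  has_lbound [set e | 0 < e /\ skorokhod_close x y e].
Proof. by exists 0 => e [/ltW]. Qed.

Lemma skorokhod_dist_lt (x y : D01) (e : R) : skorokhod_dist x y < e ->
  exists2 d, d < e & 0 < d /\ skorokhod_close x y d.
Proof.
move=> h; have [d [d0 xyd] de] := inf_lt (skorokhod_ex x y) h.
by exists d.
Qed.

Lemma skorokhod_dist_le (x y : D01) (e : R) :
  0 < e -> skorokhod_close x y e -> skorokhod_dist x y <= e.
Proof. by move=> e0 h; apply: ge_inf => //; exact: skorokhod_lb. Qed.

Lemma time_change_id : time_change id.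
Proof. by split => // u; exists u. Qed.

Lemma time_change_lt lam t u : time_change lam ->
  (\val (lam t) < \val (lam u)) = (\val t < \val u).
Proof.
move=> [inc _]; apply/idP/idP => [|/inc//]; have [//|] := ltP (\val t) (\val u).
rewrite le_eqVlt => /orP[/eqP/val_inj ->|/inc ut lt]; first by rewrite ltxx.
by have := lt_trans ut lt; rewrite ltxx.
Qed.

Lemma skorokhod_close_sym (x y : D01) e :
  skorokhod_close x y e -> skorokhod_close y x e.
Proof.
move=> [lam tc h]; have [inc sur] := tc.
have [mu lamK] := choice sur.
exists mu => [|t].
  split=> [t u tu|u]; first by rewrite -(time_change_lt _ _ tc) !lamK.
  exists (lam u); apply/val_inj/eqP; rewrite eq_le !leNgt.
  rewrite -(time_change_lt u (mu (lam u)) tc).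
  by rewrite -(time_change_lt (mu (lam u)) u tc) lamK ltxx.
by have [] := h (mu t); rewrite lamK distrC (distrC (x _)).
Qed.

Lemma skorokhod_close_trans (x y z : D01) d e :
  skorokhod_close x y d -> skorokhod_close y z e -> skorokhod_close x z (d + e).
Proof.
move=> [f [fi fs] hf] [g [gi gs] hg]; exists (g \o f) => [|t /=].
  split=> [t u /fi/gi//|u]; have [v <-] := gs u; have [w <-] := fs v.
  by exists w.
have [f1 f2] := hf t; have [g1 g2] := hg (f t); split.
  by rewrite (le_trans (ler_distD (\val (f t)) _ _))// addrC lerD.
by rewrite (le_trans (ler_distD (y (f t)) _ _))// lerD.
Qed.

Lemma skorokhod_distxx (x : D01) : skorokhod_dist x x = 0.
Proof.
apply/eqP; rewrite eq_le; apply/andP; split.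
  apply/ler_addgt0Pl => e e0; rewrite addr0; apply: skorokhod_dist_le => //.
  exists id => [|t]; first exact: time_change_id.
  by rewrite !subrr !normr0 ltW.
by apply: lb_le_inf; [exact: skorokhod_ex|move=> e [/ltW]].
Qed.

Lemma skorokhod_dist_sym (x y : D01) : skorokhod_dist x y = skorokhod_dist y x.
Proof.
rewrite /skorokhod_dist; congr inf; apply/seteqP.
by split=> e [e0 /skorokhod_close_sym].
Qed.

Lemma skorokhod_dist_triangle (y x z : D01) :
  skorokhod_dist x z <= skorokhod_dist x y + skorokhod_dist y z.
Proof.
apply/ler_addgt0Pl => e e0.
have [a a1 [a2 a3]] : exists2 d, d < skorokhod_dist x y + e / 2 &
    0 < d /\ skorokhod_close x y d by apply: skorokhod_dist_lt; lra.
have [b b1 [b2 b3]] : exists2 d, d < skorokhod_dist y z + e / 2 &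
    0 < d /\ skorokhod_close y z d by apply: skorokhod_dist_lt; lra.
have := skorokhod_dist_le (addr_gt0 a2 b2) (skorokhod_close_trans a3 b3); lra.
Qed.

Let half_step_I01 (T c : R) : 0 < c -> 0 <= T -> c <= 1 - T ->
  (0 <= T + c / 2) && (T + c / 2 <= 1).
Proof. by move=> ? ? ?; apply/andP; split; lra. Qed.

Let close_half_step (T L c d : R) : 0 < c -> d < c / 4 ->
  `|L - (T + c / 2)| <= d -> (T <= L) /\ (`|T - L| < c).
Proof.
move=> ? ?; rewrite ler_norml ltr_norml => /andP[? ?].
by split; [lra|apply/andP; split; lra].
Qed.

Let three_eps (a b p q e : R) : `|p - q| <= e / 3 -> `|a - p| < e / 3 ->
  `|b - q| < e / 3 -> `|a - b| <= e.
Proof.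
rewrite !ler_norml !ltr_norml => /andP[? ?] /andP[? ?] /andP[? ?].
by apply/andP; split; lra.
Qed.

Lemma skorokhod_dist_eq0 (x y : D01) : skorokhod_dist x y = 0 -> x = y.
Proof.
move=> xy0; apply/val_inj/funext => t; apply/eqP; rewrite -subr_eq0 -normr_le0.
apply/ler_addgt0Pl => e e0; rewrite addr0.
have [t01 t11] : 0 <= \val t /\ \val t <= 1.
  by have := set_valP t; rewrite /= in_itv /= => /andP.
have e3 : 0 < e / 3 by lra.
have [t1|t1] := ltP (\val t) 1; last first.
  have [d d1 [d2 [lam [inc sur] h]]] : exists2 d, d < e &
    0 < d /\ skorokhod_close x y d by apply: skorokhod_dist_lt; lra.
  have [_ ht] := h t; rewrite (le_trans _ (ltW d1))//.
  suff lamt : lam t = t by rewrite lamt in ht.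
  have [u ut] := sur t.
  have : (u = t) \/ \val u < \val t.
    have u1 : \val u <= \val t.
      by have := set_valP u; rewrite /= in_itv /= => /andP[_ /le_trans]; exact.
    by move: u1; rewrite le_eqVlt => /orP[/eqP/val_inj|]; [left|right].
  case=> [E|/inc]; first by rewrite -{1}E ut.
  rewrite ut => tl; have := set_valP (lam t); rewrite /= in_itv /= => /andP[_ l1].
  by move: (lt_le_trans tl l1); rewrite ltNge t1.
have [a a0 ha] := cadlag_right t (D01_cadlag x) e3.
have [b b0 hb] := cadlag_right t (D01_cadlag y) e3.
pose c := Num.min (Num.min a b) (1 - \val t).
have c0 : 0 < c by rewrite /c !lt_min a0 b0 /= subr_gt0.
have ca : c <= a by rewrite /c !ge_min lexx.
have cb : c <= b by rewrite /c !ge_min lexx orbT.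
have c1 : c <= 1 - \val t by rewrite /c !ge_min lexx !orbT.
have u01 : `[0 : R, 1]%classic (\val t + c / 2).
  by rewrite /= in_itv; exact: half_step_I01.
pose u : I01 R := exist _ (\val t + c / 2) (mem_set u01).
have [d d1 [d2 [lam _ h]]] : exists2 d, d < Num.min (e / 3) (c / 4) &
    0 < d /\ skorokhod_close x y d.
  by apply: skorokhod_dist_lt; rewrite xy0 lt_min e3 /=; lra.
move: d1; rewrite lt_min => /andP[de dc].
have [lu xl] := h u.
have aux T L := @close_half_step T L c d c0 dc.
have [l1 l2] := aux (\val t) (\val (lam u)) lu.
have xu : `|x t - x u| < e / 3.
  have [] : (\val t <= \val u) /\ (`|\val t - \val u| < c).
    by apply: aux; rewrite subrr normr0 ltW.
  by move=> ? ?; apply: ha => //; exact: lt_le_trans ca.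
have yl : `|y t - y (lam u)| < e / 3.
  by apply: hb => //; exact: lt_le_trans cb.
exact: three_eps (le_trans xl (ltW de)) xu yl.
Qed.

HB.instance Definition _ := @isMetric.Build R D01 skorokhod_dist
  skorokhod_distxx skorokhod_dist_eq0 skorokhod_dist_sym skorokhod_dist_triangle.

HB.instance Definition _ :=
  Measurable.copy C01 (borel C01).
HB.instance Definition _ :=
  Measurable.copy D01 (borel D01).

End path_types.

Section moment_classes.
Context {R : realType} {B : preTopologicalLmodType R}.
Variable N : B -> R.
Implicit Types mu nu : probability (borel B) R.

(* dfwith x i v is x with its i-th argument replaced by v. *)
Definition multilinear_form k (f : ('I_k -> B) -> R) :=
  forall (x : 'I_k -> B) (i : 'I_k), scalar (fun v : B => f (dfwith x i v)).

Definition bounded_form k (f : ('I_k -> B) -> R) :=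
  exists M : R, forall x : 'I_k -> B, `|f x| <= M * \prod_(i < k) N (x i).

Definition finite_moment (s : R) : set (probability (borel B) R) :=
  [set mu : probability (borel B) R | (\int[mu]_x (N x `^ s)%:E < +oo)%E].

(* The bound k <= ceil(s) - 1 is on integers. Equality of two integrals is read
   as including their existence, since the library's integral is total. *)
Definition same_moments (s : R) nu : set (probability (borel B) R) :=
  [set mu : probability (borel B) R | finite_moment s mu /\
    forall (k : nat) (f : ('I_k -> B) -> R),
      (1 <= k)%N -> (k%:Z <= Num.ceil s - 1)%R ->
      multilinear_form f -> bounded_form f ->
      [/\ mu.-integrable setT (fun x => (f (fun=> x))%:E),
          nu.-integrable setT (fun x => (f (fun=> x))%:E) &
          (\int[mu]_x (f (fun=> x))%:E = \int[nu]_x (f (fun=> x))%:E)%E]].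

End moment_classes.

(* Main.v *)
(* A path x is approximated by finite sums x_n = \sum_t x(t) h_n(t) of fixed
   vectors h_n(t), weighted by values of x. For a bounded form f the integral of
   f(x_n) or of f(x_n, x_n) only involves first and second order moments of the
   process, so dominated convergence gives the claim, and also the measurability
   of f on the diagonal, once f(x_n) -> f(x), respectively
   f(x_n, x_n) -> f(x, x), for every x.

   For continuous paths, piecewise linear interpolation converges uniformly. For
   cadlag paths, interpolation by step functions on refining grids does not, but
   x_n - x is then uniformly close to a combination of indicators of intervals
   [t, t'[ which shrink to t from the right and which vanish once t is in the
   grid. It is therefore enough that the grid exhausts the points t at which the
   functional f(1_[t, t'[, .) does not tend to 0 in norm. There are countably many
   of them: Littlewood's inequality bounds the number of disjoint intervals I
   for which f(1_I, .) has norm at least e. *)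
Require Import Defs.
From mathcomp Require Import all_boot all_order all_algebra.
From mathcomp Require Import all_classical all_reals all_analysis.
From mathcomp Require Import measurable_realfun ring lra.
Set Implicit Arguments.
Unset Strict Implicit.
Unset Printing Implicit Defensive.
Import Order.TTheory GRing.Theory Num.Theory.
Import numFieldNormedType.Exports.
Local Open Scope classical_set_scope.
Local Open Scope ring_scope.

(** * Littlewood's inequality *)

Section littlewood.
Variable R : rcfType.

(** In terms of [v = |S| / b] this is [v ^+ 2 - v ^+ 4 / 4 <= v]. A minorant of the absolute value
    that is an even polynomial of degree 4 has an explicit average over random signs. *)
Lemma quartic_le_norm (b S : R) : 0 <= b ->
  S ^+ 2 / b - S ^+ 4 / (4 * b ^+ 3) <= `|S|.
Proof.
rewrite le_eqVlt => /predU1P[<-|b0].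
  by rewrite expr0n /= mulr0 !invr0 !mulr0 subr0.
have [v Sv] : exists v, `|S| = b * v by exists (`|S| / b); field; rewrite gt_eqF.
have v0 : 0 <= v by rewrite -(pmulr_rge0 _ b0) -Sv.
rewrite -(ger0_norm (sqr_ge0 S)) normrX.
have -> : S ^+ 4 = `|S| ^+ 4.
  by rewrite -normrX ger0_norm// exprn_even_ge0.
rewrite Sv.
have -> : (b * v) ^+ 2 / b - (b * v) ^+ 4 / (4 * b ^+ 3) = b * (v ^+ 2 - v ^+ 4 / 4).
  by field; rewrite gt_eqF.
(* The product is [v ^+ 3] minus its tangent at 6 / 5, a rational point close to the minimiser 2 /
   sqrt 3 of [1 - v + v ^+ 3 / 4]. *)
have v3 : 0 <= (v - 6 / 5) ^+ 2 * (v + 12 / 5).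
  by rewrite mulr_ge0 ?sqr_ge0 ?addr_ge0//; lra.
have h : 0 <= v * (1 - v + v ^+ 3 / 4) by rewrite mulr_ge0//; nra.
rewrite ler_pM2l//; lra.
Qed.

(* For a Rademacher sum with partial sum S whose remaining terms have variance A,
   this bounds from below the conditional expectation of the left-hand side of
   [quartic_le_norm] at the full sum: the fourth moment of the remaining terms is
   at most 3 A^2. *)
Definition quartic (b S A : R) : R :=
  (S ^+ 2 + A) / b - (S ^+ 4 + 6 * S ^+ 2 * A + 3 * A ^+ 2) / (4 * b ^+ 3).

(** The second moments agree. In the fourth moment, 3 times the squared variance on the left exceeds
    the average on the right by [2 * a ^+ 4], and this term enters with a negative sign. *)
Lemma quartic_average (b S A a : R) : 0 <= b ->
  quartic b S (a ^+ 2 + A) <= (quartic b (S + a) A + quartic b (S - a) A) / 2.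
Proof.
move=> b0; rewrite /quartic -subr_ge0.
set u := b^-1; set w := (4 * b ^+ 3)^-1.
have w0 : 0 <= w by rewrite invr_ge0 mulr_ge0// exprn_ge0.
rewrite [X in 0 <= X](_ : _ = 2 * a ^+ 4 * w); last by field.
by apply: mulr_ge0 => //; rewrite pmulr_rge0// exprn_even_ge0.
Qed.

(* Derandomized Khintchine inequality: the signs are chosen one after the other,
   so that the conditional expectation does not decrease. *)
Lemma quartic_signs (T : eqType) (J : Type) (s : seq T) (js : seq J)
    (a : T -> J -> R) (b : J -> R) (S : J -> R) :
  uniq s -> (forall j, 0 <= b j) ->
  exists2 sg : T -> R, (forall t, `|sg t| = 1) &
    \sum_(j <- js) quartic (b j) (S j) (\sum_(t <- s) a t j ^+ 2) <=
    \sum_(j <- js) quartic (b j) (S j + \sum_(t <- s) sg t * a t j) 0.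
Proof.
move=> + b0; elim: s S => [|t s IH] S /=.
  exists (fun=> 1) => [t|]; first exact: normr1.
  by apply: ler_sum => j _; rewrite !big_nil addr0.
move=> /andP[ts us].
pose L := \sum_(j <- js) quartic (b j) (S j) (\sum_(t <- t :: s) a t j ^+ 2).
have [e e1 he] : exists2 e : R, `|e| = 1 & L <=
  \sum_(j <- js) quartic (b j) (S j + e * a t j) (\sum_(t <- s) a t j ^+ 2).
  have : L <= (\sum_(j <- js) quartic (b j) (S j + 1 * a t j) (\sum_(t <- s) a t j ^+ 2) +
    \sum_(j <- js) quartic (b j) (S j + (- 1) * a t j) (\sum_(t <- s) a t j ^+ 2)) / 2.
    rewrite /L -big_split /= mulr_suml; apply: ler_sum => j _.
    by rewrite big_cons mul1r mulN1r; exact: quartic_average.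
  set p := (X in X + _); set q := (X in _ + X) => h.
  have [pq|pq] := leP p q; [exists (-1)|exists 1]; rewrite ?normrN ?normr1//.
    by apply: le_trans h _; rewrite -/q; lra.
  by apply: le_trans h _; rewrite -/p; lra.
have [sg sg1 hsg] := IH (fun j => S j + e * a t j) us.
exists (fun u => if u == t then e else sg u) => [u|]; first by case: ifP.
apply: le_trans he _; apply: le_trans hsg _; apply: ler_sum => j _.
rewrite big_cons eqxx addrA (_ : \sum_(i <- s) sg i * a i j =
  \sum_(j0 <- s) (if j0 == t then e else sg j0) * a j0 j)//.
by apply: eq_big_seq => u us'; rewrite ifN//; apply: contraNneq ts => <-.
Qed.

(** Cauchy-Schwarz against the constant 1, by induction on [s] after squaring. *)
Lemma sum_norm_le_sqrt (T : Type) (s : seq T) (a : T -> R) :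
  \sum_(t <- s) `|a t| <=
  Num.sqrt (size s)%:R * Num.sqrt (\sum_(t <- s) a t ^+ 2).
Proof.
have A0 (l : seq T) : 0 <= \sum_(t <- l) a t ^+ 2.
  by apply: sumr_ge0 => t _; exact: sqr_ge0.
have B0 (l : seq T) : 0 <= \sum_(t <- l) `|a t| by exact: sumr_ge0.
rewrite -sqrtrM ?ler0n// -(ger0_norm (B0 s)) -sqrtr_sqr ler_sqrt ?mulr_ge0//.
elim: s => [|t s IH]; first by rewrite !big_nil mul0r expr2 mul0r.
rewrite !big_cons /= -natr1 -[a t ^+ 2]real_normK ?num_real//.
have := A0 s; have := B0 s; move: IH.
have n0 : 0 <= (size s)%:R :> R by exact: ler0n.
have : (size s)%:R = 0 :> R -> \sum_(t <- s) `|a t| = 0.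
  by move=> /eqP; rewrite pnatr_eq0 => /eqP/size0nil ->; rewrite big_nil.
move: n0 (\sum_(t <- s) `|a t|) (\sum_(t <- s) a t ^+ 2) `|a t| => n0 y A x.
move: (size s)%:R n0 => n n0 ny yA y0 {}A0.
suff : 2 * (x * y) <= n * x ^+ 2 + A by lra.
have [n_0|n_gt] := eqVneq n 0.
  by rewrite ny// n_0 !mulr0 mul0r add0r.
have {}n_gt : 0 < n by rewrite lt_neqAle eq_sym n_gt.
(* After multiplication by [n], the goal follows from this square and [y ^+ 2 <= n * A]. *)
have h := sqr_ge0 (n * x - y).
rewrite -(ler_pM2l n_gt); nra.
Qed.

(** Khintchine bounds the sum of the Euclidean norms of the columns by [4 * M]; Cauchy-Schwarz in
    each column then costs the factor [Num.sqrt (size s)%:R]. *)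
Lemma bimatrix_sum_le (T J : eqType) (s : seq T) (js : seq J) (a : T -> J -> R) (M : R) :
  uniq s ->
  (forall (sg : T -> R) (tau : J -> R), (forall t, `|sg t| <= 1) ->
    (forall j, `|tau j| <= 1) ->
    \sum_(t <- s) \sum_(j <- js) sg t * tau j * a t j <= M) ->
  \sum_(t <- s) \sum_(j <- js) `|a t j| <= 4 * Num.sqrt (size s)%:R * M.
Proof.
move=> us hM.
pose A j := \sum_(t <- s) a t j ^+ 2.
have A0 j : 0 <= A j by apply: sumr_ge0 => t _; exact: sqr_ge0.
pose b j := Num.sqrt (A j).
have b0 j : 0 <= b j by exact: sqrtr_ge0.
have bA j : b j ^+ 2 = A j by rewrite sqr_sqrtr.
have [sg sg1 hsg] := quartic_signs js a (fun=> 0) us b0.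
pose S j := \sum_(t <- s) sg t * a t j.
have SM : \sum_(j <- js) `|S j| <= M.
  (* Taking the signs of the [S j] as column signs turns the signed sum into the sum of the
     [|S j|]. *)
  apply: le_trans (hM sg (fun j => Num.sg (S j)) _ _).
  - rewrite exchange_big; apply: ler_sum => j _ /=.
    under eq_bigr do rewrite mulrAC mulrC.
    by rewrite -mulr_sumr normrEsg.
  - by move=> t; rewrite sg1.
  - by move=> j; rewrite normr_sg; case: eqP.
have hb : \sum_(j <- js) b j / 4 <= M.
  apply: le_trans SM; apply: le_trans (le_trans hsg _); last first.
    apply: ler_sum => j _; apply: le_trans (quartic_le_norm (S j) (b0 j)).
    by rewrite /quartic add0r mulr0 expr0n /= mulr0 !addr0.
  (* Since [b j ^+ 2 = A j], the quartic at 0 is [b j - 3 / 4 * b j]; this is where the constant 4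
     comes from. *)
  apply: ler_sum => j _; rewrite -/(A j) -bA /quartic expr0n /=.
  have [->|bj] := eqVneq (b j) 0; first by rewrite !expr0n /= !(invr0, mulr0, mul0r, subr0).
  by rewrite le_eqVlt; apply/orP; left; apply/eqP; field.
rewrite exchange_big /=.
apply: (@le_trans _ _ (\sum_(j <- js) Num.sqrt (size s)%:R * b j)).
  by apply: ler_sum => j _; exact: sum_norm_le_sqrt.
move: hb; rewrite -mulr_sumr -mulr_suml => hb.
have := ler_wpM2l (sqrtr_ge0 (size s)%:R) hb; lra.
Qed.

End littlewood.

(** * Step functions on a finite grid *)

Section scalar.
Context {R : pzRingType} {B : lmodType R}.
Variables (phi : B -> R) (lphi : scalar phi).

Lemma lform0 : phi 0 = 0.
Proof. by have := lphi (-1) 0 0; rewrite scaler0 addr0 mulN1r addNr. Qed.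

Lemma lformZ a u : phi (a *: u) = a * phi u.
Proof. by rewrite -[a *: u]addr0 lphi lform0 addr0. Qed.

Lemma lformD u v : phi (u + v) = phi u + phi v.
Proof. by rewrite -[u]scale1r lphi mul1r scale1r. Qed.

Lemma lformB u v : phi (u - v) = phi u - phi v.
Proof. by rewrite -scaleN1r lformD lformZ mulN1r. Qed.

Lemma lform_sum (T : Type) (s : seq T) (c : T -> R) (v : T -> B) :
  phi (\sum_(t <- s) c t *: v t) = \sum_(t <- s) c t * phi (v t).
Proof.
elim: s => [|t s IH]; first by rewrite !big_nil lform0.
by rewrite !big_cons lformD lformZ IH.
Qed.

End scalar.

Section cadlag_steps.
Context {R : realType}.
Implicit Types (x : D01 R) (t u : I01 R).

Lemma I01_ge0 t : 0 <= \val t.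
Proof. by have := set_valP t; rewrite /= in_itv /= => /andP[]. Qed.

Lemma I01_le1 t : \val t <= 1.
Proof. by have := set_valP t; rewrite /= in_itv /= => /andP[]. Qed.

Lemma clamp01 (r : R) : `[0 : R, 1]%classic (Num.max 0 (Num.min 1 r)).
Proof. by rewrite /= in_itv /= le_max lexx /= ge_max ler01 ge_min lexx. Qed.

Definition clamp (r : R) : I01 R := exist _ (Num.max 0 (Num.min 1 r)) (mem_set (clamp01 r)).

Lemma clampE (r : R) : 0 <= r <= 1 -> \val (clamp r) = r.
Proof. by move=> /andP[r0 r1]; rewrite /clamp /= min_r// max_r. Qed.

Definition ico_fun (a b : R) : I01 R -> R := fun t => (a <= \val t < b)%R%:R.

(** On each side of a point the indicator is constant up to some positive distance. *)
Lemma ico_cadlag a b : cadlag (ico_fun a b).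
Proof.
pose const (d : R) (l : R) t (D : set (I01 R)) :=
  forall u, D u -> `|\val t - \val u| < d -> ico_fun a b u = l.
have aux d l t D : 0 < d -> const d l t D -> ico_fun a b u @[u --> within D (nbhs t)] --> l.
  move=> d0 h; apply/within_I01P => e e0; exists d => // u Du ut.
  by rewrite (h u)// subrr normr0.
move=> t; split.
  have [ta|at_] := ltP (\val t) a.
    apply: (aux (a - \val t)); first by lra.
    move=> u tu; rewrite ltr_norml => /andP[h1 h2]; have {}tu : \val t <= \val u := tu.
    rewrite /ico_fun [a <= \val t]leNgt ta [a <= \val u]leNgt.
    by have -> : \val u < a by lra.
  have [tb|bt] := ltP (\val t) b.
    apply: (aux (b - \val t)); first by lra.
    move=> u tu; rewrite ltr_norml => /andP[h1 h2]; have {}tu : \val t <= \val u := tu.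
    by rewrite /ico_fun at_ tb (le_trans at_ tu); have -> : \val u < b by lra.
  apply: (aux 1) => // u tu _; rewrite /ico_fun !ltNge bt (le_trans bt tu).
  by rewrite !andbF.
have [ta|at_] := leP (\val t) a.
  exists 0; apply: (aux 1) => // u ut _; rewrite /ico_fun leNgt.
  by rewrite (lt_le_trans ut ta).
have [tb|bt] := leP (\val t) b.
  exists 1; apply: (aux (\val t - a)); first by lra.
  move=> u ut; rewrite ltr_norml => /andP[h1 h2]; have {}ut : \val u < \val t := ut.
  by rewrite /ico_fun (lt_le_trans ut tb); have -> : a <= \val u by lra.
exists 0; apply: (aux (\val t - b)); first by lra.
move=> u ut; rewrite ltr_norml => /andP[h1 h2]; have {}ut : \val u < \val t := ut.
have bu : b <= \val u by lra.
rewrite /ico_fun [\val u < b]ltNge bu. by rewrite /= andbF.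
Qed.

Definition ico (a b : R) : D01 R := CadlagPath (mem_set (@ico_cadlag a b)).

Lemma D01_scalar t : scalar (fun x => x t).
Proof. by []. Qed.

Lemma D01_sumE (T : Type) (s : seq T) (c : T -> R) (v : T -> D01 R) t :
  (\sum_(i <- s) c i *: v i) t = \sum_(i <- s) c i * v i t.
Proof. exact: (lform_sum (D01_scalar t)). Qed.

Lemma D01_subE (x y : D01 R) t : (x - y) t = x t - y t.
Proof. exact: (lformB (D01_scalar t)). Qed.

Lemma D01_norm_ub x t : `|x t| <= supnorm x.
Proof. exact/supnorm_ub/D01_bounded. Qed.

Lemma D01_norm_ge0 x : 0 <= supnorm x.
Proof. exact/supnorm_ge0/D01_bounded. Qed.

Lemma D01_normZ (a : R) x : supnorm (a *: x) <= `|a| * supnorm x.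
Proof.
apply: supnorm_le => t; rewrite -[X in X <= _]/(`|a * x t|) normrM.
by apply: ler_wpM2l => //; exact: D01_norm_ub.
Qed.

Lemma D01_norm_eq0 x : supnorm x = 0 -> x = 0.
Proof.
move=> x0; apply/val_inj/funext => t; apply/eqP.
by rewrite -normr_le0; have := D01_norm_ub x t; rewrite x0.
Qed.

Implicit Types G : seq (I01 R).

(* The right end of the cell of [g] in the partition by [G]; the value 2 makes
   the last cell contain the point 1. *)
Definition cell_end G (g : I01 R) : R :=
  \big[Num.min/2]_(u <- G | \val g < \val u) \val u.

(** When no grid point follows [g], both sides are true, since the default 2 exceeds every time. *)
Lemma lt_cell_end G g t :
  (\val t < cell_end G g) = all (fun u => (\val g < \val u) ==> (\val t < \val u)) G.
Proof.
rewrite /cell_end; elim: G => [|u G IH] /=.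
  by rewrite big_nil (le_lt_trans (I01_le1 t))// ltr1n.
by rewrite big_cons; case: ifP => //= _; rewrite lt_min IH.
Qed.

Lemma gt_cell_end G g : \val g < cell_end G g.
Proof. by rewrite lt_cell_end; apply/allP => u _; apply/implyP. Qed.

Lemma cell_end_val G g : cell_end G g = 2 \/ exists2 u, u \in G & cell_end G g = \val u.
Proof.
rewrite /cell_end; elim: G => [|u G IH]; first by rewrite big_nil; left.
rewrite big_cons; case: ifP => _; last first.
  by case: IH => [|[v vG]]; [left|right; exists v => //; rewrite inE vG orbT].
rewrite minElt; case: ifP => _; first by right; exists u => //; rewrite inE eqxx.
by case: IH => [|[v vG]]; [left|right; exists v => //; rewrite inE vG orbT].
Qed.

Definition cell G (g : I01 R) : D01 R := ico (\val g) (cell_end G g).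

Lemma cellE G g t : cell G g t = (\val g <= \val t < cell_end G g)%R%:R.
Proof. by []. Qed.

(** If one point came strictly before the other, its cell would end at the other one at the latest
    and could not contain [t]. *)
Lemma cell_disjoint G g g' t : g \in G -> g' \in G ->
  \val g <= \val t < cell_end G g -> \val g' <= \val t < cell_end G g' -> g = g'.
Proof.
move=> gG gG' /andP[gt]; rewrite lt_cell_end => /allP/(_ _ gG')/implyP h.
move=> /andP[gt']; rewrite lt_cell_end => /allP/(_ _ gG)/implyP h'.
apply/val_inj/eqP; rewrite eq_le !leNgt; apply/andP; split; apply/negP.
- by move=> /h'; rewrite ltNge gt.
- by move=> /h; rewrite ltNge gt'.
Qed.

Lemma cell_sum_le1 G t : uniq G -> \sum_(g <- G) cell G g t <= 1.
Proof.
move=> uG.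
have [/hasP[g gG gt]|/hasPn no] :=
    boolP (has (fun g : I01 R => \val g <= \val t < cell_end G g) G); last first.
  by rewrite big_seq big1// => g /no; rewrite cellE => /negbTE ->.
rewrite (bigD1_seq g)// cellE gt big_seq_cond big1 => [|u /andP[uG' ug]].
  by rewrite /= addr0.
rewrite cellE; case: (boolP (\val u <= \val t < cell_end G u)) => // ut; move: ug.
by rewrite (cell_disjoint uG' gG ut gt) eqxx.
Qed.

(** [p] is the largest grid point that does not exceed [t]; [zero01] ensures that there is one. *)
Lemma pred_grid G t : zero01 \in G -> exists2 p, p \in G &
  \val p <= \val t < cell_end G p.
Proof.
move=> G0.
suff [p pG [pt h]] : exists2 p, p \in G & \val p <= \val t /\
    forall u, u \in G -> \val u <= \val t -> \val u <= \val p.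
  exists p => //; rewrite pt lt_cell_end; apply/allP => u uG; apply/implyP.
  by rewrite !ltNge; apply: contra; exact: h.
have : zero01 \in [seq u <- G | \val u <= \val t].
  by rewrite mem_filter G0 /= I01_ge0.
move: (zero01) => z zG.
have [p ph hp] : exists2 p, p \in [seq u <- G | \val u <= \val t] &
   forall u, u \in [seq u <- G | \val u <= \val t] -> \val u <= \val p.
  elim: [seq u <- G | \val u <= \val t] z zG => // u s IH z _.
  have [|s0] := eqVneq s [::].
    by move=> ->; exists u => [|v]; rewrite ?inE// => /eqP ->.
  have [v vs] : exists v, v \in s.
    by case: s s0 {IH} => // v s _; exists v; rewrite inE eqxx.
  have [p ps hp] := IH _ vs.
  have [pu|up] := leP (\val p) (\val u).
    exists u => [|w]; rewrite inE ?eqxx// => /predU1P[->//|/hp wp].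
    exact: le_trans pu.
  exists p => [|w]; rewrite inE ?ps ?orbT// => /predU1P[->|/hp//].
  exact: ltW.
move: ph; rewrite mem_filter => /andP[pt pG]; exists p => //; split => // u uG ut.
by apply: hp; rewrite mem_filter ut.
Qed.

(** The vectors [h] are left free: indicators of cells serve for cadlag paths, tent functions for
    continuous ones. *)
Definition interp (B : lmodType R) (path : B -> I01 R -> R) (G : seq (I01 R))
  (h : I01 R -> B) (x : B) : B := \sum_(g <- G) path x g *: h g.

Definition step_interp G x : D01 R := interp (@cadlag_path R) G (cell G) x.

Lemma step_interpE G x p t : uniq G -> p \in G -> \val p <= \val t < cell_end G p ->
  step_interp G x t = x p.
Proof.
move=> uG pG pt; rewrite /step_interp /interp D01_sumE (bigD1_seq p)// cellE pt mulr1
  big_seq_cond big1 => [|u /andP[uG' up]].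
  by rewrite /= addr0.
rewrite cellE; case: (boolP (\val u <= \val t < cell_end G u)) => [ut|_]; last by rewrite mulr0.
by move: up; rewrite (cell_disjoint uG' pG ut pt) eqxx.
Qed.

Lemma step_interp_norm G x : uniq G -> zero01 \in G -> supnorm (step_interp G x) <= supnorm x.
Proof.
move=> uG G0; apply: supnorm_le => t; have [p pG pt] := pred_grid t G0.
by rewrite (step_interpE _ uG pG pt) D01_norm_ub.
Qed.

(** The classical partition of a cadlag path into cells of small oscillation. The supremum of the
    [c] for which [0, c[ has such a grid is attained because of left limits, and is 1 because of
    right continuity. *)
Lemma cadlag_oscillation x (e : R) : 0 < e -> exists G : seq (I01 R),
  forall s t, \val s <= \val t ->
    (forall g, g \in G -> ~~ (\val s < \val g <= \val t)) -> `|x s - x t| < e.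
Proof.
move=> e0.
pose Q (c : R) := exists G : seq (I01 R), forall s t, \val s <= \val t ->
  \val t < c -> (forall g, g \in G -> ~~ (\val s < \val g <= \val t)) -> `|x s - x t| < e.
have Qle c c' : c <= c' -> Q c' -> Q c.
  by move=> cc' [G hG]; exists G => s t st tc; apply: hG => //; exact: lt_le_trans cc'.
(* Adding [t] to the grid prolongs it from [0, t[ to [0, c[, because two times on different sides of
   [t] are then separated. *)
have Qext t (c : R) l : Q (\val t) -> (forall u, \val t <= \val u < c -> `|l - x u| < e / 2) -> Q c.
  move=> [G hG] h; exists (t :: G) => s u su uc nG.
  have [ut|tu] := ltP (\val u) (\val t).
    by apply: hG => // g gG; apply: nG; rewrite inE gG orbT.
  have ts : \val t <= \val s.
    by move: (nG t); rewrite inE eqxx tu andbT -leNgt => /(_ isT).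
  have := h s; rewrite ts (le_lt_trans su uc) => /(_ isT) hs.
  have := h u; rewrite tu uc => /(_ isT) hu.
  rewrite (le_lt_trans (ler_distD l _ _))// distrC; lra.
have Q0 : Q 0.
  by exists [::] => s t _; rewrite ltNge I01_ge0.
have toI (c : R) : 0 <= c <= 1 -> exists t : I01 R, \val t = c.
  by move=> /clampE c01; exists (clamp c).
suff [G hG] : Q 1.
  have [w w1] : exists t : I01 R, \val t = 1 by apply: toI; rewrite ler01 lexx.
  (* [Q 1] does not reach the time 1, which gets a cell of its own. *)
  exists (w :: G) => s t st nG.
  have [t1|t1] := ltP (\val t) 1.
    by apply: hG => // g gG; apply: nG; rewrite inE gG orbT.
  have : \val t <= \val s.
    by move: (nG w); rewrite inE eqxx w1 t1 andbT -leNgt => /(_ isT); exact/le_trans/I01_le1.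
  by move=> ts; have -> : s = t; [apply/val_inj/le_anti/andP|rewrite subrr normr0].
pose S := [set c : R | 0 <= c <= 1 /\ Q c].
have S0 : S 0 by split => //; rewrite lexx ler01.
have hS : has_sup S by split; [exists 0|exists 1 => c [/andP[]]].
have [s0 s1] : 0 <= sup S /\ sup S <= 1.
  by split; [apply: ub_le_sup => //; exact: hS.2|apply: ge_sup; [exists 0|move=> c [/andP[]]]].
have [t ts] := toI _ (introT andP (conj s0 s1)).
have e2 : 0 < e / 2 by rewrite divr_gt0.
have [/within_I01P/(_ _ e2)[d d0 hd] [l /within_I01P/(_ _ e2)[d' d'0 hd']]] := D01_cadlag x t.
(* Left limit: the path stays close to [l] between some [c] of [S] and [sup S]. *)
have QS : Q (sup S).
  have [c [c01 Qc] cs] := sup_adherent d'0 hS.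
  have [u uc] := toI _ c01.
  apply: (Qext u _ l); first by rewrite uc.
  move=> v /andP[uv vs]; apply: hd'; first by have : \val v < \val t by rewrite ts.
  rewrite ts ger0_norm; last by rewrite subr_ge0 ltW.
  by move: uv; rewrite uc; lra.
move: s1; rewrite le_eqVlt => /predU1P[<-//|s1].
(* Right continuity: if [sup S] is below 1, the grid extends beyond it, a contradiction. *)
have [c [cs cd c1]] : exists c : R, [/\ sup S < c, c <= sup S + d & c <= 1].
  exists (Num.min (sup S + d) 1).
  by split; rewrite ?lt_min ?ltrDl ?d0 ?s1// !ge_min lexx ?orbT.
have : c <= sup S.
  apply: ub_le_sup; first exact: hS.2.
  split; first by rewrite (le_trans s0 (ltW cs)).
  apply: (Qext t _ (x t)); first by rewrite ts.
  move=> u /andP[tu uc]; apply: hd => //.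
  by rewrite distrC ger0_norm ?subr_ge0//; move: ts; lra.
by rewrite leNgt cs.
Qed.

End cadlag_steps.

(** * Bilinear forms on cadlag paths *)

(** Starting with [x0] covers an empty [A] and later puts the time 0 into every grid. *)
Lemma countable_enum (T : Type) (A : set T) (x0 : T) : countable A ->
  exists q : nat -> T, q 0%N = x0 /\ forall a, A a -> exists k, q k = a.
Proof.
move=> /countable_injP[f injf].
have [q hq] : {q : nat -> T & forall k, (exists2 a, A a & f a = k) -> A (q k) /\ f (q k) = k}.
  apply: (@choice nat T (fun k b => (exists2 a, A a & f a = k) -> A b /\ f b = k)) => k.
  have [[a Aa fa]|no] := pselect (exists2 a, A a & f a = k); first by exists a.
  by exists x0.
exists (fun k => if k is k'.+1 then q k' else x0); split=> // a Aa.
have [Aq fq] := hq (f a) (ex_intro2 _ _ a Aa erefl).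
by exists (f a).+1; apply: injf => //; exact/mem_set.
Qed.

Section step_approximation.
Context {R : realType}.
Implicit Types (x y : D01 R) (t u : I01 R) (G : seq (I01 R)).

(** No point of [G], hence none of [G0], separates [t] from the left end [p] of its cell, and the
    interpolant equals [x p] at [t]. *)
Lemma step_interp_close G0 G x (e : R) : 0 <= e ->
  (forall s t, \val s <= \val t ->
    (forall g, g \in G0 -> ~~ (\val s < \val g <= \val t)) -> `|x s - x t| < e) ->
  {subset G0 <= G} -> uniq G -> zero01 \in G -> supnorm (x - step_interp G x) <= e.
Proof.
move=> e0 osc sub uG G0'; apply: supnorm_le => t; rewrite D01_subE.
have [p pG /andP[pt tp]] := pred_grid t G0'.
rewrite (step_interpE _ uG pG) ?pt// distrC ltW// osc// => g /sub gG.
apply/negP => /andP[pg gt].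
by move: tp; rewrite lt_cell_end => /allP/(_ _ gG)/implyP/(_ pg); rewrite ltNge gt.
Qed.

Lemma step_interp_linear G (x y : D01 R) (a : R) :
  step_interp G (a *: x + y) = a *: step_interp G x + step_interp G y.
Proof.
rewrite /step_interp /interp scaler_sumr -big_split /=; apply: eq_bigr => g _.
by rewrite scalerA -scalerDl.
Qed.

Lemma ico_norm (a b : R) : supnorm (ico a b) <= 1.
Proof.
apply: supnorm_le => t; rewrite /= /ico_fun normr_nat lern1.
by case: (_ <= _ < _).
Qed.

(** All times lie below 2, so [ico a 2] is the indicator of the times from [a] on. *)
Lemma icoB (a b : R) : a <= b -> b <= 2 -> ico a b = ico a 2 - ico b 2.
Proof.
move=> ab b2; apply/val_inj/funext => t.
rewrite -[RHS]/(ico_fun a 2 t - ico_fun b 2 t) -[LHS]/(ico_fun a b t) /ico_fun.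
have -> : \val t < 2 by rewrite (le_lt_trans (I01_le1 t))// ltr1n.
rewrite !andbT; have [bt|tb] := leP b (\val t).
  by rewrite andbF (le_trans ab bt) subrr.
by rewrite andbT subr0.
Qed.

Lemma icoxx (a : R) : ico a a = 0.
Proof.
apply/val_inj/funext => t; rewrite -[LHS]/(ico_fun a a t) /ico_fun.
by case: leP.
Qed.

(** The comparison is weak, unlike in [cell_end]: a grid point rounds to itself, and the indicator
    starting there is interpolated exactly. *)
Definition round_up G (c : R) : R := \big[Num.min/2]_(u <- G | c <= \val u) \val u.

Lemma lt_round_up G (c : R) t :
  (\val t < round_up G c) = all (fun u : I01 R => (c <= \val u) ==> (\val t < \val u)) G.
Proof.
rewrite /round_up; elim: G => [|u G IH] /=.
  by rewrite big_nil (le_lt_trans (I01_le1 t))// ltr1n.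
by rewrite big_cons; case: ifP => //= _; rewrite lt_min IH.
Qed.

Lemma round_up_le G c u : u \in G -> c <= \val u -> round_up G c <= \val u.
Proof.
move=> uG cu; rewrite leNgt lt_round_up; apply/allPn; exists u => //.
by rewrite cu ltxx.
Qed.

Lemma round_up_ge G c : c <= 2 -> c <= round_up G c.
Proof.
move=> c2; rewrite /round_up; elim: G => [|u G IH]; first by rewrite big_nil.
by rewrite big_cons; case: ifP => //= cu; rewrite le_min cu.
Qed.

Lemma round_up_le2 G c : round_up G c <= 2.
Proof.
rewrite /round_up; elim: G => [|u G IH]; first by rewrite big_nil.
by rewrite big_cons; case: ifP => //= cu; rewrite ge_min IH orbT.
Qed.

(** The interpolant takes at [t] the value at the last grid point [p] up to [t], and [c <= \val p]
    holds exactly when some grid point lies in [c, t]. *)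
Lemma step_interp_upper G (c : R) : uniq G -> zero01 \in G ->
  step_interp G (ico c 2) = ico (round_up G c) 2.
Proof.
move=> uG G0; apply/val_inj/funext => t; have [p pG /andP[pt tp]] := pred_grid t G0.
rewrite -[LHS]/(step_interp G (ico c 2) t) (step_interpE _ uG pG) ?pt//.
rewrite -[LHS]/(ico_fun c 2 p) -[RHS]/(ico_fun (round_up G c) 2 t) /ico_fun.
have lt2 u : \val u < 2 by rewrite (le_lt_trans (I01_le1 u))// ltr1n.
rewrite !lt2 !andbT; congr (nat_of_bool _)%:R; apply/idP/idP => [cp|].
  by rewrite (le_trans (round_up_le pG cp)).
rewrite leNgt lt_round_up => /allPn[u uG']; rewrite negb_imply -leNgt => /andP[cu ut].
rewrite (le_trans cu)// leNgt; apply/negP => pu.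
by move: tp; rewrite lt_cell_end => /allP/(_ _ uG')/implyP/(_ pu); rewrite ltNge ut.
Qed.

(** Repetitions are removed because a repeated point would contribute its cell twice. *)
Definition grid (q : nat -> I01 R) n := undup [seq q i | i <- iota 0 n.+1].

Lemma mem_grid q n k : (k <= n)%N -> q k \in grid q n.
Proof. by move=> kn; rewrite mem_undup map_f// mem_iota add0n ltnS. Qed.

Section bounded_bilinear.
Variables (g : D01 R -> D01 R -> R) (M : R).
Hypotheses (gl : forall y, scalar (g ^~ y)) (gr : forall x, scalar (g x)).
Hypotheses (M0 : 0 <= M) (gM : forall x y, `|g x y| <= M * supnorm x * supnorm y).

(* The points at which t |-> g(1_[0, t[, .) has right oscillation larger than e for
   the dual norm. *)
Definition right_jump (e : R) : set (I01 R) := [set t | forall d : R, 0 < d ->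
  exists b y, \val t < b < \val t + d /\ e * supnorm y < `|g (ico (\val t) b) y|].

(** Taking for [d] the distance to the end of the cell of [t] makes the intervals of distinct points
    of [s] disjoint. The strict inequality forces [y] to be nonzero, so that it can be
    normalised. *)
Let right_jump_witness (e : R) (s : seq (I01 R)) t : 0 < e -> right_jump e t ->
  exists p : R * D01 R, [/\ \val t < p.1, p.1 <= cell_end s t,
    supnorm p.2 <= 1 & e < `|g (ico (\val t) p.1) p.2| ].
Proof.
move=> e0 bt.
have [|b [y [/andP[tb bd] hy]]] := bt (cell_end s t - \val t).
  by rewrite subr_gt0 gt_cell_end.
exists (b, (supnorm y)^-1 *: y) => /=; split => //.
- by rewrite ltW//; move: bd; rewrite addrC subrK.
- apply: (le_trans (D01_normZ _ _)); rewrite ger0_norm ?invr_ge0 ?D01_norm_ge0//.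
  have [->|n0] := eqVneq (supnorm y) 0; first by rewrite mulr0.
  by rewrite mulVf.
- have n0 : supnorm y != 0.
    apply/eqP => /D01_norm_eq0 y0.
    by move: hy; rewrite y0 (lform0 (gr _)) normr0 ltNge mulr_ge0// ?D01_norm_ge0// ltW.
  have n1 : 0 < supnorm y by rewrite lt_neqAle eq_sym n0 D01_norm_ge0.
  by rewrite (lformZ (gr _)) normrM ger0_norm ?invr_ge0 ?ltW// ltr_pdivlMl// mulrC.
Qed.

(** Each point of [s] yields an interval and a path of norm at most 1 on which [g] exceeds [e] in
    modulus. Once the paths are discretised on a common grid, every row of the matrix [a] has
    absolute sum at least [e / 2], while all signed sums are at most [M]; Littlewood's inequality
    then bounds the number of rows. *)
Let right_jump_size (e : R) (s : seq (I01 R)) : 0 < e -> uniq s ->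
  (forall t, t \in s -> right_jump e t) -> (size s)%:R <= (8 * M / e) ^+ 2.
Proof.
move=> e0 us bs.
have wit t : exists p : R * D01 R, t \in s ->
    [/\ \val t < p.1, p.1 <= cell_end s t,
    supnorm p.2 <= 1 & e < `|g (ico (\val t) p.1) p.2| ].
  have [ts|] := boolP (t \in s); last by exists (0, 0).
  by have [p hp] := right_jump_witness s e0 (bs _ ts); exists p.
have [f hf] := choice wit.
(* The discretisation error [M * e'] is to be at most [e / 2]; [M + 1] guards against [M = 0]. *)
pose e' := e / (2 * (M + 1)).
have M1 : 0 < M + 1 by rewrite ltr_wpDl.
have e'0 : 0 < e' by rewrite divr_gt0// mulr_gt0.
have Me' : M * e' <= e / 2.
  have -> : e / 2 = (M + 1) * e' by rewrite /e'; field; rewrite gt_eqF.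
  by rewrite ler_pM2r// lerDl.
have [Go hGo] := choice (fun t => cadlag_oscillation (f t).2 e'0).
pose G := undup (zero01 :: flatten [seq Go t | t <- s]).
have uG : uniq G by exact: undup_uniq.
have G0 : zero01 \in G by rewrite mem_undup inE eqxx.
have Gsub t : t \in s -> {subset Go t <= G}.
  move=> ts u ut; rewrite mem_undup inE; apply/orP; right.
  by apply/flattenP; exists (Go t) => //; exact: map_f.
pose I t := ico (\val t) (f t).1.
pose a t u := g (I t) (cell G u).
have lower t : t \in s -> e / 2 <= \sum_(u <- G) `|a t u|.
  move=> ts; have [h1 h2 h3 h4] := hf _ ts.
  have cl := step_interp_close (ltW e'0) (hGo t) (Gsub _ ts) uG G0.
  have -> : e / 2 = e - e / 2 by lra.
  rewrite lerBlDl (le_trans (ltW h4))//.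
  rewrite -[X in g _ X](subrK (step_interp G (f t).2)) (lformD (gr _)).
  apply: (le_trans (ler_normD _ _)); apply: lerD.
    apply: (le_trans (gM _ _)); apply: le_trans Me'; apply: ler_pM => //.
    + by rewrite mulr_ge0// D01_norm_ge0.
    + exact: D01_norm_ge0.
    + by rewrite -[leRHS]mulr1 ler_wpM2l// ico_norm.
  rewrite /step_interp /interp (lform_sum (gr _)); apply: (le_trans (ler_norm_sum _ _ _)).
  apply: ler_sum => u _; rewrite normrM ler_piMl//.
  exact: le_trans (D01_norm_ub _ _) h3.
have upper : \sum_(t <- s) \sum_(u <- G) `|a t u| <= 4 * Num.sqrt (size s)%:R * M.
  apply: bimatrix_sum_le => // sg tau sg1 tau1.
  (* The signed sum is [g] at two combinations of disjoint indicators, both of norm at most 1. *)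
  have -> : \sum_(t <- s) \sum_(u <- G) sg t * tau u * a t u =
      g (\sum_(t <- s) sg t *: I t) (\sum_(u <- G) tau u *: cell G u).
    rewrite (lform_sum (gl _)); apply: eq_bigr => t _.
    rewrite (lform_sum (gr _)) mulr_sumr; apply: eq_bigr => u _.
    by rewrite mulrA.
  have sum1 (r : seq (I01 R)) (c : I01 R -> R) (v : I01 R -> D01 R) : uniq r ->
      (forall t, `|c t| <= 1) ->
      (forall t, t \in r -> forall u, 0 <= v t u <= cell r t u) ->
      supnorm (\sum_(t <- r) c t *: v t) <= 1.
    move=> ur c1 hv; apply: supnorm_le => u; rewrite D01_sumE.
    apply: (le_trans (ler_norm_sum _ _ _)).
    apply: le_trans (cell_sum_le1 u ur); rewrite big_seq [leRHS]big_seq.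
    apply: ler_sum => t tr; have /andP[v0 v1] := hv _ tr u.
    by rewrite normrM (ger0_norm v0); apply: le_trans v1; rewrite ler_piMl.
  apply: (le_trans (ler_norm _)); apply: (le_trans (gM _ _)).
  rewrite -mulrA -[leRHS]mulr1 ler_wpM2l//.
  apply: mulr_ile1; rewrite ?D01_norm_ge0//.
    apply: sum1 => // t ts u; have [h1 h2 _ _] := hf _ ts.
    rewrite ler0n /= /ico_fun ler_nat; case: (boolP (_ <= _ < _)) => // /andP[tu ut].
    by rewrite tu (lt_le_trans ut).
  by apply: sum1 => // t ts u; rewrite lexx andbT ler0n.
have : (size s)%:R * (e / 2) <= 4 * Num.sqrt (size s)%:R * M.
  apply: le_trans upper.
  have -> : (size s)%:R * (e / 2) = \sum_(t <- s) e / 2.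
    by rewrite big_const_seq count_predT iter_addr_0 mulr_natl.
  rewrite [leLHS]big_seq [leRHS]big_seq.
  by apply: ler_sum => t ts; exact: lower.
(* Here [h] reads [r ^+ 2 * (e / 2) <= 4 * r * M]; division by [r] gives [r <= 8 * M / e]. *)
set r := Num.sqrt _ => h.
have r2 : (size s)%:R = r ^+ 2 by rewrite sqr_sqrtr// ler0n.
have r0 : 0 <= r by exact: sqrtr_ge0.
have [->|rn0] := eqVneq (size s)%:R (0 : R); first exact: sqr_ge0.
have rp : 0 < r.
  rewrite lt_neqAle r0 andbT eq_sym; apply: contraNneq rn0.
  by rewrite r2 => ->; rewrite expr0n.
rewrite r2 ler_pXn2r ?nnegrE//; last by rewrite divr_ge0 ?mulr_ge0// ltW.
rewrite ler_pdivlMr//.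
rewrite -(ler_pM2l rp); move: h; rewrite r2; nra.
Qed.

(** The size bound holds for all finite subsets, so the set is even finite. *)
Lemma right_jump_countable (e : R) : 0 < e -> countable (right_jump e).
Proof.
move=> e0; apply: finite_set_countable; apply: contrapT => inf.
pose n := Num.trunc ((8 * M / e) ^+ 2).
have [B Bbad nB] := infinite_set_fset n.+1 inf.
have /= := @right_jump_size e (finmap.enum_fset B) e0 (finmap.fset_uniq B) (fun t tB => Bbad t tB).
rewrite leNgt => /negP; apply.
apply: (lt_le_trans (truncnS_gt _)).
by rewrite ler_nat.
Qed.

(** This is convergence of [g (v n)] to 0 in the norm dual to [supnorm]. It can hold for
    interpolation errors that do not tend to 0 uniformly. *)
Definition form_null (v : nat -> D01 R) := forall e : R, 0 < e ->
  exists n0, forall n, (n0 <= n)%N -> forall y, `|g (v n) y| <= e * supnorm y.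

Lemma form_null0 : form_null (fun=> 0).
Proof.
move=> e e0; exists 0%N => n _ y.
by rewrite (lform0 (gl _)) normr0 mulr_ge0 ?D01_norm_ge0// ltW.
Qed.

Lemma form_nullD v w : form_null v -> form_null w -> form_null (fun n => v n + w n).
Proof.
move=> sv sw e e0; have e2 : 0 < e / 2 by rewrite divr_gt0.
have [m hm] := sv _ e2; have [n hn] := sw _ e2.
exists (maxn m n) => k; rewrite geq_max => /andP[mk nk] y.
rewrite (lformD (gl _)) (le_trans (ler_normD _ _))//.
have := hm _ mk y; have := hn _ nk y; nra.
Qed.

Lemma form_nullZ (a : R) v : form_null v -> form_null (fun n => a *: v n).
Proof.
move=> sv e e0; have a1 : 0 < `|a| + 1 by rewrite ltr_wpDl.
have [|n hn] := sv (e / (`|a| + 1)); first by rewrite divr_gt0.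
exists n => k nk y; rewrite (lformZ (gl _)) normrM.
have -> : e = (`|a| + 1) * (e / (`|a| + 1)) by field; rewrite gt_eqF.
rewrite -mulrA; apply: ler_pM => //; first by rewrite lerDl.
exact: hn.
Qed.

Lemma form_null_sum (T : Type) (s : seq T) (c : T -> R) (v : T -> nat -> D01 R) :
  (forall i, form_null (v i)) -> form_null (fun n => \sum_(i <- s) c i *: v i n).
Proof.
move=> sv; elim: s => [|i s IH].
  by under eq_fun do rewrite big_nil; exact: form_null0.
under eq_fun do rewrite big_cons.
by apply: form_nullD IH; exact: form_nullZ.
Qed.

Variable q : nat -> I01 R.
Hypotheses (q0 : q 0%N = zero01) (q1 : exists k, \val (q k) = 1).
Hypothesis qdense : forall t (d : R), \val t < 1 -> 0 < d ->
  exists k, \val t < \val (q k) < \val t + d.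
Hypothesis qbad : forall m t, right_jump m.+1%:R^-1 t -> exists k, q k = t.

Let uG n : uniq (grid q n).
Proof. exact: undup_uniq. Qed.

Let G0 n : zero01 \in grid q n.
Proof. by rewrite -q0 mem_grid. Qed.

(** The error is minus the indicator of [c, c'[, where c' is [c] rounded up to the grid. It vanishes
    once [c] is in the grid or is 2; otherwise [c] is no right jump of [g], and c' approaches it
    from the right. *)
Lemma form_null_upper (c : R) : c = 2 \/ (exists t : I01 R, c = \val t) ->
  form_null (fun n => step_interp (grid q n) (ico c 2) - ico c 2).
Proof.
move=> hc e e0.
have c2 : c <= 2.
  by case: hc => [->//|[t ->]]; rewrite (le_trans (I01_le1 t))// ler1n.
have diff n : step_interp (grid q n) (ico c 2) - ico c 2 = - ico c (round_up (grid q n) c).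
  by rewrite step_interp_upper// [in RHS]icoB ?round_up_ge ?round_up_le2// opprB.
suff [n0 h] : exists n0, forall n, (n0 <= n)%N -> forall y,
    `|g (ico c (round_up (grid q n) c)) y| <= e * supnorm y.
  exists n0 => n nn y; rewrite diff -scaleN1r (lformZ (gl _)) normrM normrN1 mul1r.
  exact: h.
have triv n : round_up (grid q n) c = c -> forall y,
    `|g (ico c (round_up (grid q n) c)) y| <= e * supnorm y.
  move=> -> y; rewrite icoxx (lform0 (gl _)) normr0.
  by rewrite mulr_ge0 ?D01_norm_ge0// ltW.
case: hc => [c_2|[t ct]].
  exists 0%N => n _; apply: triv; apply/le_anti; rewrite round_up_ge// andbT.
  by rewrite [leRHS]c_2 round_up_le2.
have [[k qk]|noq] := pselect (exists k, q k = t).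
  exists k => n kn; apply: triv; apply/le_anti; rewrite round_up_ge// andbT.
  by rewrite [leRHS]ct -qk round_up_le ?mem_grid// ct qk.
(* The time 1 is enumerated by [q], so [t] lies before it and density applies to its right. *)
have t1 : \val t < 1.
  rewrite lt_neqAle I01_le1 andbT; apply/eqP => t1; apply: noq.
  by have [k qk] := q1; exists k; apply/val_inj; rewrite qk t1.
pose m := Num.trunc e^-1.
have me : m.+1%:R^-1 <= e.
  rewrite -[leRHS]invrK lef_pV2 ?posrE ?invr_gt0 ?ltr0n//.
  exact/ltW/truncnS_gt.
(* Otherwise [t] would be a right jump at level [m.+1%:R^-1], hence enumerated by [q]. *)
have [d d0 hd] : exists2 d : R, 0 < d & forall b y,
    \val t < b < \val t + d -> `|g (ico (\val t) b) y| <= m.+1%:R^-1 * supnorm y.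
  apply: contrapT => nd; apply: noq; apply: (@qbad m) => d d0.
  apply: contrapT => nb; apply: nd; exists d => // b y hb.
  by rewrite leNgt; apply/negP => gb; apply: nb; exists b, y.
have [k /andP[tk kd]] := qdense t1 d0.
exists k => n kn.
have up : round_up (grid q n) c <= \val (q k).
  by rewrite round_up_le ?mem_grid// ct ltW.
have := round_up_ge (grid q n) c2; rewrite le_eqVlt => /predU1P[/esym/triv//|lt] y.
apply: (@le_trans _ _ (m.+1%:R^-1 * supnorm y)); last by rewrite ler_wpM2r ?D01_norm_ge0.
by rewrite {1}ct hd// -{1}ct lt (le_lt_trans up).
Qed.

(** The path is uniformly within [e'] of a step function [z]. Interpolation does not increase the
    norm, so [x - z] contributes at most [2 * M * e' * supnorm y]; the indicators composing [z] are
    covered by [form_null_upper]. *)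
Lemma form_null_step_interp x : form_null (fun n => step_interp (grid q n) x - x).
Proof.
move=> e e0.
pose e' := e / (4 * (M + 1)).
have M1 : 0 < M + 1 by rewrite ltr_wpDl.
have e'0 : 0 < e' by rewrite divr_gt0// mulr_gt0.
have Me' : M * e' <= e / 4.
  have -> : e / 4 = (M + 1) * e' by rewrite /e'; field; rewrite gt_eqF.
  by rewrite ler_pM2r// lerDl.
have [Go hGo] := cadlag_oscillation x e'0.
pose G := undup (zero01 :: Go).
have cl : supnorm (x - step_interp G x) <= e'.
  apply: (step_interp_close (ltW e'0) hGo); rewrite ?undup_uniq ?mem_undup ?inE ?eqxx//.
  by move=> u uGo; rewrite mem_undup inE uGo orbT.
set z := step_interp G x in cl *.
have zE : z = \sum_(u <- G) x u *: (ico (\val u) 2 - ico (cell_end G u) 2).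
  apply: eq_bigr => u _; rewrite -icoB ?(ltW (gt_cell_end _ _))//.
  case: (cell_end_val G u) => [->|[v _ ->]]; first by rewrite lexx.
  by rewrite (le_trans (I01_le1 v))// ler1n.
have sz : form_null (fun n => step_interp (grid q n) z - z).
  suff -> : (fun n => step_interp (grid q n) z - z) = fun n => \sum_(u <- G) x u *:
     ((step_interp (grid q n) (ico (\val u) 2) - ico (\val u) 2) +
      (-1) *: (step_interp (grid q n) (ico (cell_end G u) 2) - ico (cell_end G u) 2)).
    apply: form_null_sum => u; apply: form_nullD.
      by apply: form_null_upper; right; exists u.
    apply: form_nullZ; apply: form_null_upper.
    by case: (cell_end_val G u) => [->|[v _ ->]]; [left|right; exists v].
  apply/funext => n; rewrite zE.
  have lin (H l : seq (I01 R)) (a b : I01 R -> D01 R) :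
      step_interp H (\sum_(u <- l) x u *: (a u - b u)) =
      \sum_(u <- l) x u *: (step_interp H (a u) - step_interp H (b u)).
    elim: l => [|u l IH].
      by rewrite !big_nil /step_interp /interp big1// => u _; exact: scale0r.
    rewrite !big_cons step_interp_linear IH; congr (_ *: _ + _).
    by rewrite addrC -scaleN1r step_interp_linear scaleN1r addrC.
  rewrite lin -sumrB; apply: eq_bigr => u _.
  by rewrite -scalerBr; congr (_ *: _); rewrite scaleN1r !opprB addrACA [RHS]addrACA [- _ - _]addrC.
have e2 : 0 < e / 2 by rewrite divr_gt0.
have [n0 hn0] := sz _ e2.
exists n0 => n nn y.
have -> : step_interp (grid q n) x - x =
    (step_interp (grid q n) z - z) + (step_interp (grid q n) (x - z) - (x - z)).
  have := step_interp_linear (grid q n) (x - z) z 1; rewrite !scale1r subrK => ->.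
  by rewrite opprB addrACA addKr; congr (_ - _); rewrite addrC.
rewrite (lformD (gl _)) (le_trans (ler_normD _ _))//.
have h1 := hn0 _ nn y.
have b (w : D01 R) : supnorm w <= e' -> `|g w y| <= e / 4 * supnorm y.
  move=> we; apply: (le_trans (gM _ _)); rewrite ler_wpM2r ?D01_norm_ge0//.
  by apply: le_trans Me'; rewrite ler_wpM2l.
have h2 := b _ (le_trans (step_interp_norm (x - z) (uG n) (G0 n)) cl).
have h3 := b _ cl.
have h4 := ler_normB (g (step_interp (grid q n) (x - z)) y) (g (x - z) y).
rewrite -(lformB (gl y)) in h4.
apply: (le_trans (lerD h1 (le_trans h4 (lerD h2 h3)))).
by lra.
Qed.

End bounded_bilinear.

(** The clamped rationals supply density and the end point 1; the points of [A] are added to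
    them. *)
Lemma exists_grid (A : set (I01 R)) : countable A -> exists q : nat -> I01 R,
  [/\ q 0%N = zero01, exists k, \val (q k) = 1,
    (forall t (d : R), \val t < 1 -> 0 < d ->
      exists k, \val t < \val (q k) < \val t + d) &
    forall t, A t -> exists k, q k = t].
Proof.
move=> cA.
pose Q : set (I01 R) := range (fun r : rat => clamp (ratr r)).
have cQ : countable Q.
  exact: (sub_countable (card_image_le _ _) (countableP _)).
have cU : countable (\bigcup_(b in [set: bool]) if b then A else Q).
  by apply: bigcup_countable => // -[].
have [q [q0 hq]] := countable_enum zero01 cU.
have hqQ r : exists k, q k = clamp (ratr r).
  by apply: hq; exists false => //; exists r.
exists q; split=> //.
- have [k qk] := hqQ 1.
  by exists k; rewrite qk rmorph1 clampE// ler01 lexx.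
- move=> t d t1 d0.
  have [|r] := @rat_in_itvoo R (\val t) (Num.min 1 (\val t + d)).
    by rewrite lt_min t1 ltrDl.
  rewrite in_itv /= => /andP[tr]; rewrite lt_min => /andP[r1 rd].
  have [k qk] := hqQ r.
  by exists k; rewrite qk clampE ?tr// (ltW r1) andbT (le_trans (I01_ge0 t))// ltW.
- by move=> t At; apply: hq; exists true.
Qed.

End step_approximation.

(** * Measurability in the Skorokhod topology *)

Lemma measurable_fun_gt (R : realType) d (T : measurableType d) (f : T -> R) :
  (forall a, measurable [set x | a < f x]) -> measurable_fun setT f.
Proof.
move=> mf; apply: (measurability (@RGenOInfty.G R)); first exact: RGenOInfty.measurableE.
move=> _ [_ [a ->] <-]; rewrite setTI.
by under eq_set do rewrite /= in_itv /= andbT; exact: mf.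
Qed.

Lemma invS_lt (R : realType) (e : R) : 0 < e -> exists n, n.+1%:R^-1 < e.
Proof.
move=> e0; exists (Num.trunc e^-1).
by rewrite -[ltRHS]invrK ltf_pV2 ?posrE ?invr_gt0 ?ltr0n// truncnS_gt.
Qed.

Section skorokhod_measurability.
Context {R : realType}.

(** Some time change moves every point of the graph, in time and in value, by less than a given
    number above the Skorokhod distance; a visit to an open rectangle therefore persists nearby. *)
Lemma D01_open_visit (V W : set R) : open V -> open W ->
  open [set x : D01 R | exists2 u : I01 R, V (\val u) & W (x u)].
Proof.
move=> oV oW; rewrite openE => x [u Vu Wu].
have /nbhs_ballP[e1 /= e10 h1] := open_nbhs_nbhs (conj oV Vu).
have /nbhs_ballP[e2 /= e20 h2] := open_nbhs_nbhs (conj oW Wu).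
apply/nbhs_ballP; exists (Num.min e1 e2) => /=; first by rewrite lt_min e10.
move=> y xy.
have [d dlt [d0 [lam _ h]]] := skorokhod_dist_lt (xy : skorokhod_dist x y < _).
move: dlt; rewrite lt_min => /andP[d1 d2]; have [l1 l2] := h u.
exists (lam u).
  by apply: h1; rewrite /ball /= distrC; exact: le_lt_trans d1.
by apply: h2; rewrite /ball /=; exact: le_lt_trans d2.
Qed.

(** A time change fixes 1, being increasing and onto, so close paths have close values there. *)
Lemma D01_open_end (W : set R) (t : I01 R) : \val t = 1 -> open W ->
  open [set x : D01 R | W (x t)].
Proof.
move=> t1 oW; rewrite openE => x Wx.
have /nbhs_ballP[e /= e0 h] := open_nbhs_nbhs (conj oW Wx).
apply/nbhs_ballP; exists e => //= y xy.
have [d de [d0 [lam [inc sur] hl]]] := skorokhod_dist_lt (xy : skorokhod_dist x y < _).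
have [_] := hl t; suff -> : lam t = t.
  by move=> l2; apply: h; rewrite /ball /=; exact: le_lt_trans de.
have [u ut] := sur t; have : \val u <= \val t by rewrite t1 I01_le1.
rewrite le_eqVlt; move=> /predU1P[/val_inj E|/inc]; first by rewrite -{1}E.
by rewrite ut => /lt_le_trans/(_ (I01_le1 _)); rewrite t1 ltxx.
Qed.

Lemma D01_measurable_open (A : set (D01 R)) : open A -> measurable A.
Proof. by move=> oA; apply: sub_sigma_algebra. Qed.

(** The norm exceeds [a] exactly when the path visits the open set of values of modulus above
    [a]. *)
Lemma D01_supnorm_measurable : measurable_fun setT (fun x : D01 R => supnorm x).
Proof.
apply: measurable_fun_gt => a; apply: D01_measurable_open.
have oW : open [set r : R | a < `|r|].
  apply: (@open_comp _ _ (fun r : R => `|r|) [set r | a < r]); last exact: open_gt.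
  by move=> r _; exact: norm_continuous.
have := D01_open_visit openT oW; congr open; apply/seteqP; split => x.
  by move=> [u _ au]; exact: lt_le_trans (D01_norm_ub x u).
move=> /= ax; apply: contrapT => no; move: ax; apply/negP; rewrite -leNgt.
by apply: supnorm_le => u; rewrite leNgt; apply/negP => au; apply: no; exists u.
Qed.

(* For t < 1, x(t) > a if and only if x >= a + 1/n on ]t, t + 1/m[ for some n and m,
   which is a closed condition. Every time change fixes t = 1. *)
Lemma D01_eval_measurable (t : I01 R) : measurable_fun setT (fun x : D01 R => x t).
Proof.
apply: measurable_fun_gt => a.
have := I01_le1 t; rewrite le_eqVlt => /predU1P[t1|t1].
  by apply: D01_measurable_open; exact: (D01_open_end t1 (@open_gt _ a)).
pose V m := [set r : R | \val t < r] `&` [set r | r < \val t + m.+1%:R^-1].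
pose W n := [set r : R | r < a + n.+1%:R^-1].
have -> : [set x : D01 R | a < x t] = \bigcup_n \bigcup_m
    ~` [set x : D01 R | exists2 u : I01 R, V m (\val u) & W n (x u)].
  apply/seteqP; split => x /=.
    move=> ax; have ax2 : 0 < (x t - a) / 2 by rewrite divr_gt0// subr_gt0.
    have [n n1] := invS_lt ax2; have [d d0 hd] := cadlag_right t (D01_cadlag x) ax2.
    have [m md] := invS_lt d0.
    exists n => //; exists m => // -[u [/= tu um] um'].
    have {}tu : \val t < \val u := tu; have {}um : \val u < \val t + m.+1%:R^-1 := um.
    have := hd u (ltW tu); rewrite ltr0_norm ?subr_lt0//.
    have -> : - (\val t - \val u) < d.
      by rewrite opprB ltrBlDl (lt_trans um)// ltrD2l.
    move=> /(_ isT); rewrite ltr_norml => /andP[_ h].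
    by move: um' n1 h; rewrite /W /=; move: (n.+1%:R^-1) => z; lra.
  move=> [n _ [m _ h]].
  have n0 : 0 < n.+1%:R^-1 :> R by rewrite invr_gt0 ltr0n.
  have [d d0 hd] := cadlag_right t (D01_cadlag x) n0.
  (* The time [\val t + c / 2] lies in the window [V m], within reach of right continuity, and
     before 1. *)
  pose c := Num.min (Num.min d m.+1%:R^-1) (1 - \val t).
  have c0 : 0 < c by rewrite !lt_min d0 invr_gt0 ltr0n subr_gt0.
  have cd : c <= d by rewrite !ge_min lexx.
  have cm : c <= m.+1%:R^-1 by rewrite !ge_min lexx orbT.
  have ct : c <= 1 - \val t by rewrite !ge_min lexx orbT.
  have v01 : 0 <= \val t + c / 2 <= 1.
    by have := I01_ge0 t; move=> ?; apply/andP; split; lra.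
  have u01 : `[0 : R, 1]%classic (\val t + c / 2) by [].
  pose u : I01 R := exist _ (\val t + c / 2) (mem_set u01).
  have uE : \val u = \val t + c / 2 by [].
  have tu : \val t < \val u by rewrite uE; lra.
  have um : \val u < \val t + m.+1%:R^-1.
    by rewrite uE; move: cm; move: (m.+1%:R^-1) => z; lra.
  have xu : a + n.+1%:R^-1 <= x u.
    by rewrite leNgt; apply/negP => xu; apply: h; exists u.
  have := hd u (ltW tu); rewrite ltr0_norm ?subr_lt0//.
  have -> : - (\val t - \val u) < d by rewrite uE; lra.
  move=> /(_ isT); rewrite ltr_norml => /andP[h1 h2].
  by move: xu h1 h2; move: (n.+1%:R^-1) => z; lra.
apply: bigcupT_measurable => n; apply: bigcupT_measurable => m.
apply: measurableC; apply: D01_measurable_open; apply: D01_open_visit.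
  by apply: openI; [exact: open_gt|exact: open_lt].
exact: open_lt.
Qed.

End skorokhod_measurability.

(** * From interpolation to equality of moments *)

Section same_integral.
Context d (T : measurableType d) (R : realType) (mu nu : probability T R).

Definition same_integral (f : T -> R) :=
  [/\ mu.-integrable setT (EFin \o f), nu.-integrable setT (EFin \o f) &
      (\int[mu]_x (f x)%:E = \int[nu]_x (f x)%:E)%E].

Lemma same_integral_sum (I : Type) (s : seq I) (c : I -> R) (f : I -> T -> R) :
  (forall i, same_integral (f i)) ->
  same_integral (fun x => \sum_(i <- s) c i * f i x).
Proof.
move=> hf; elim: s => [|i s [IH1 IH2 IH3]].
  have -> : (fun x => \sum_(i <- [::]) c i * f i x) = cst 0.
    by apply/funext => x; rewrite big_nil.
  split; [exact: integrable0|exact: integrable0|].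
  by rewrite !integral0.
have [h1 h2 h3] := hf i.
have -> : (fun x => \sum_(i <- i :: s) c i * f i x) =
    ((fun x => c i * f i x) \+ (fun x => \sum_(i <- s) c i * f i x)).
  by apply/funext => x; rewrite big_cons.
have i1 := integrableZl measurableT (c i) h1.
have i2 := integrableZl measurableT (c i) h2.
split.
- exact: (integrableD measurableT i1 IH1).
- exact: (integrableD measurableT i2 IH2).
rewrite (integralD_EFin measurableT i1 IH1) (integralD_EFin measurableT i2 IH2).
congr (_ + _)%E; last exact: IH3.
rewrite (integralZl measurableT h1) (integralZl measurableT h2).
by congr (_ * _)%E.
Qed.

(** Dominated convergence under each law, then uniqueness of limits. The measurability of [F] also
    comes from the pointwise convergence. *)
Lemma same_integral_lim (f : nat -> T -> R) (F G : T -> R) :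
  (forall n, same_integral (f n)) -> (forall n x, `|f n x| <= G x) ->
  mu.-integrable setT (EFin \o G) -> nu.-integrable setT (EFin \o G) ->
  (forall x, f n x @[n --> \oo] --> F x) -> same_integral F.
Proof.
move=> hf fG muG nuG cvf.
have mf n : measurable_fun setT (EFin \o f n).
  by have [/integrableP[]] := hf n.
have mF : measurable_fun setT (EFin \o F).
  apply/measurable_EFinP; apply: (measurable_fun_cvg (h := f)) => //.
  by move=> n; exact/measurable_EFinP/mf.
have cv x : (EFin \o f n) x @[n --> \oo] --> (EFin \o F) x.
  by apply: cvg_EFin; [exact: nearW|exact: cvf].
have dom (m : probability T R) : m.-integrable setT (EFin \o G) ->
    m.-integrable setT (EFin \o F) /\
    (\int[m]_x (f n x)%:E @[n --> \oo] --> \int[m]_x (F x)%:E)%E.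
  move=> mG; have [] := @dominated_convergence _ _ _ m _ measurableT
     (fun n => EFin \o f n) (EFin \o F) (EFin \o G) mf mF.
  - by apply: aeW => x _; exact: cv.
  - exact: mG.
  - by apply: aeW => x n _ /=; rewrite lee_fin.
  - by [].
have [m1 m2] := dom mu muG; have [n1 n2] := dom nu nuG.
have e : (fun n => \int[mu]_x (f n x)%:E)%E = (fun n => \int[nu]_x (f n x)%:E)%E.
  by apply/funext => n; have [] := hf n.
rewrite e in m2.
by split => //; exact: (cvg_unique _ m2 n2).
Qed.

End same_integral.

Section power_integrable.
Context d (T : measurableType d) (R : realType) (mu : probability T R).

(** N^k is at most 1 + N^s: it is bounded by 1 where N <= 1 and by N^s elsewhere. *)
Lemma integrable_dominated_power (N f : T -> R) (s : R) (k : nat) :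
  measurable_fun setT N -> (forall x, 0 <= N x) ->
  (\int[mu]_x (N x `^ s)%:E < +oo)%E -> k%:R <= s ->
  measurable_fun setT f -> (forall x, `|f x| <= N x ^+ k) ->
  mu.-integrable setT (EFin \o f).
Proof.
move=> mN N0 fin ks mf fN.
have ms : measurable_fun setT (fun x => N x `^ s).
  by apply: (@measurableT_comp _ _ _ _ _ _ (fun y : R => y `^ s) _ N).
have iN : mu.-integrable setT (EFin \o (fun x => N x `^ s)).
  apply/integrableP; split; first exact/measurable_EFinP.
  apply: le_lt_trans fin; rewrite le_eqVlt; apply/orP; left; apply/eqP.
  by apply: eq_integral => x _ /=; rewrite ger0_norm// powR_ge0.
have i1 := finite_measure_integrable_cst mu (1 : R) (measurableT : measurable [set: T]).
apply: (le_integrable measurableT _ _ (integrableD measurableT i1 iN)).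
  exact/measurable_EFinP.
move=> x _ /=; rewrite lee_fin (le_trans (fN x))// ger0_norm; last first.
  by rewrite addr_ge0// powR_ge0.
have [N1|N1] := leP (N x) 1.
  by rewrite (le_trans (exprn_ile1 _ _ N1))// lerDl powR_ge0.
by rewrite -powR_mulrn// (le_trans (ler_powR (ltW N1) ks))// lerDr.
Qed.

End power_integrable.

(** The norm bound provides the dominating function. Convergence is required only after applying
    [F], and the grids may depend on [F], because cadlag interpolants need not converge
    uniformly. *)
Definition interpolates {R : realType} {B : lmodType R} (path : B -> I01 R -> R)
    (F : B -> R) (s : nat -> seq (I01 R)) (h : nat -> I01 R -> B) := forall x : B,
  (forall n, supnorm (path (interp path (s n) (h n) x)) <= supnorm (path x)) /\
  F (interp path (s n) (h n) x) @[n --> \oo] --> F x.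

(** * Laws on a path space with interpolation, uniformly for both spaces *)

Section path_space.
Context {R : realType} {B : preTopologicalLmodType R}.
Variable path : B -> I01 R -> R.
Let N (x : B) := supnorm (path x).

Hypothesis path_bounded : forall x, bounded_path (path x).
Hypothesis path_measurable : forall t,
  measurable_fun setT (fun x : borel B => path x t).
Hypothesis supnorm_measurable : measurable_fun setT (fun x : borel B => N x).
Hypothesis linear_interp : forall (phi : B -> R) (M : R), scalar phi ->
  (forall x, `|phi x| <= M * N x) -> exists s h, interpolates path phi s h.
Hypothesis bilinear_interp : forall (g : B -> B -> R) (M : R),
  (forall y, scalar (g ^~ y)) -> (forall x, scalar (g x)) ->
  (forall x y, `|g x y| <= M * N x * N y) ->
  exists s h, interpolates path (fun x => g x x) s h.

Let N0 x : 0 <= N x.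
Proof. exact/supnorm_ge0/path_bounded. Qed.

Let pathN x t : `|path x t| <= N x.
Proof. exact/supnorm_ub/path_bounded. Qed.

Lemma path_integrable (mu : probability (borel B) R) (s : R) t :
  finite_moment N s mu -> 1 <= s -> mu.-integrable setT (fun x => (path x t)%:E).
Proof.
move=> fin s1; apply: (@integrable_dominated_power _ _ _ mu N (fun x => path x t) s 1) => //.
Qed.

Lemma path_mul_integrable (mu : probability (borel B) R) (s : R) t u :
  finite_moment N s mu -> 2 <= s ->
  mu.-integrable setT (fun x => (path x t * path x u)%:E).
Proof.
move=> fin s2.
apply: (@integrable_dominated_power _ _ _ mu N (fun x => path x t * path x u) s 2) => //.
  exact: measurable_funM.
by move=> x; rewrite normrM expr2 ler_pM.
Qed.

Section two_laws.
Variables (s : R) (mu nu : probability (borel B) R).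
Hypotheses (fmu : finite_moment N s mu) (fnu : finite_moment N s nu).

Let power_integrable (m : probability (borel B) R) (M : R) k : finite_moment N s m ->
  k%:R <= s -> m.-integrable setT (EFin \o (fun x => M * N x ^+ k)).
Proof.
move=> fm ks.
suff h : m.-integrable setT (EFin \o (fun x => N x ^+ k)).
  exact: (integrableZl measurableT M h).
apply: (@integrable_dominated_power _ _ _ m N (fun x => N x ^+ k) s k) => //.
  exact: measurable_funX.
by move=> x; rewrite ger0_norm// exprn_ge0.
Qed.

(** At an interpolant, [phi] is a finite combination of values of the path, so its integral is
    determined by the means. *)
Lemma linear_same_integral (phi : B -> R) (M : R) : 0 <= M -> 1 <= s ->
  (forall t, same_integral mu nu (fun x => path x t)) ->
  scalar phi -> (forall x, `|phi x| <= M * N x) -> same_integral mu nu phi.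
Proof.
move=> M0 s1 ev lphi bphi; have [l [h hlh]] := linear_interp lphi bphi.
apply: (@same_integral_lim _ _ _ mu nu (fun n x => phi (interp path (l n) (h n) x))
  phi (fun x => M * N x ^+ 1)).
- move=> n; under eq_fun do rewrite /interp (lform_sum lphi).
  under eq_fun do under eq_bigr do rewrite mulrC.
  exact: same_integral_sum.
- move=> n x; apply: (le_trans (bphi _)); rewrite ler_wpM2l// expr1.
  by have [hN _] := hlh x; exact: hN.
- exact: (@power_integrable _ M 1 fmu s1).
- exact: (@power_integrable _ M 1 fnu s1).
- by move=> x; have [] := hlh x.
Qed.

(** At an interpolant, the form is a finite combination of products of two values of the path. *)
Lemma bilinear_same_integral (g : B -> B -> R) (M : R) : 0 <= M -> 2 <= s ->
  (forall t u, same_integral mu nu (fun x => path x t * path x u)) ->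
  (forall y, scalar (g ^~ y)) -> (forall x, scalar (g x)) ->
  (forall x y, `|g x y| <= M * N x * N y) -> same_integral mu nu (fun x => g x x).
Proof.
move=> M0 s2 ev gl gr bg; have [l [h hlh]] := bilinear_interp gl gr bg.
apply: (@same_integral_lim _ _ _ mu nu
  (fun n x => g (interp path (l n) (h n) x) (interp path (l n) (h n) x))
  (fun x => g x x) (fun x => M * N x ^+ 2)).
- move=> n.
  (* The factor 1 gives the outer sum the shape of [same_integral_sum]. *)
  have -> : (fun x : borel B => g (interp path (l n) (h n) x) (interp path (l n) (h n) x)) =
      fun x => \sum_(t <- l n) 1 * \sum_(u <- l n) g (h n t) (h n u) * (path x t * path x u).
    apply/funext => x; rewrite /interp (lform_sum (gl _)); apply: eq_bigr => t _.
    rewrite mul1r (lform_sum (gr _)) mulr_sumr; apply: eq_bigr => u _.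
    by rewrite mulrA mulrC.
  by apply: same_integral_sum => t; exact: same_integral_sum.
- move=> n x; apply: (le_trans (bg _ _)); rewrite expr2 -mulrA ler_wpM2l//.
  by have [hN _] := hlh x; apply: ler_pM => //; exact: hN.
- exact: (@power_integrable _ M 2 fmu s2).
- exact: (@power_integrable _ M 2 fnu s2).
- by move=> x; have [] := hlh x.
Qed.

(** The condition on [k] amounts to [k%:R < s], so only the degrees 1 and 2 occur. *)
Lemma same_moments_of_paths : s <= 3 ->
  (1 < s -> forall t, (\int[mu]_x (path x t)%:E = \int[nu]_x (path x t)%:E)%E) ->
  (2 < s -> forall t u,
    (\int[mu]_x (path x t * path x u)%:E = \int[nu]_x (path x t * path x u)%:E)%E) ->
  same_moments N s nu mu.
Proof.
move=> s3 e1 e2; split=> // k f k1; rewrite lerBrDr lezD1 ceil_gt_int => ks mf [M bf].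
have {}ks : k%:R < s by [].
have k3 : (k < 3)%N by rewrite -(ltr_nat R) (lt_le_trans ks).
have bfM (x : 'I_k -> B) : `|f x| <= `|M| * \prod_(i < k) N (x i).
  by rewrite (le_trans (bf x))// ler_wpM2r ?ler_norm// prodr_ge0.
case: k k1 k3 => [//|[|[|//]]] _ _ in f mf bf bfM ks *.
  apply: (@linear_same_integral (fun x => f (fun=> x)) `|M|) => //.
  - exact: ltW.
  - by move=> t; split; [exact: path_integrable fmu (ltW ks)|
      exact: path_integrable fnu (ltW ks)|exact: e1].
  - move=> a u v; have := mf (fun=> 0) ord0 a u v.
    have E w : dfwith (fun=> 0) ord0 w = (fun=> w) :> ('I_1 -> B).
      by apply/funext => i; rewrite (_ : i = ord0) ?dfwithin//; exact: ord1.
    by rewrite !E.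
  - by move=> x; have := bfM (fun=> x); rewrite big_ord1.
(* A form of degree 2 is read as a function of two separate arguments. *)
pose pair (x y : B) : 'I_2 -> B := fun i => if i == ord0 then x else y.
have pairE (x : B) : (fun=> x) = pair x x by apply/funext => i; rewrite /pair if_same.
suff : same_integral mu nu (fun x => f (pair x x)).
  by rewrite /same_integral; under [in X in _ -> X]eq_fun do rewrite pairE.
apply: (@bilinear_same_integral (fun x y => f (pair x y)) `|M|) => //.
- exact: ltW.
- by move=> t u; split; [exact: path_mul_integrable fmu (ltW ks)|
    exact: path_mul_integrable fnu (ltW ks)|exact: e2].
- move=> y a u v; have := mf (pair 0 y) ord0 a u v.
  have E w : dfwith (pair 0 y) ord0 w = pair w y.
    apply/funext => i; have [->|i0] := eqVneq i ord0; first by rewrite dfwithin.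
    by rewrite dfwithout 1?eq_sym// /pair (negbTE i0).
  by rewrite !E.
- move=> x a u v; have := mf (pair x 0) ord_max a u v.
  have E w : dfwith (pair x 0) ord_max w = pair x w.
    apply/funext => i; have [->|i0] := eqVneq i ord_max; first by rewrite dfwithin.
    rewrite dfwithout 1?eq_sym// /pair.
    by case: i i0 => -[|[|]].
  by rewrite !E.
- by move=> x y; have := bfM (pair x y); rewrite big_ord_recl big_ord1 mulrA.
Qed.

End two_laws.

Section random_path.
Context d (Omega : measurableType d) (P : probability Omega R).
Variables (X : {mfun Omega >-> borel B}) (s : R).
Let mu : probability (borel B) R := distribution P X.
Hypothesis moment : ('E_P[(fun w => (N (X w) `^ s)%R)] < +oo)%E.

Let measurable_comp_path (f : borel B -> R) : measurable_fun setT f ->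
  measurable_fun setT (fun w => f (X w)).
Proof.
by move=> mf; apply: (@measurableT_comp _ _ _ _ _ _ f _ X).
Qed.

Lemma distribution_finite_moment : finite_moment N s mu.
Proof.
rewrite /finite_moment /= ge0_integral_distribution.
- by move: moment; rewrite unlock.
- apply/measurable_EFinP.
  by apply: (@measurableT_comp _ _ _ _ _ _ (fun y : R => y `^ s) _ (N : borel B -> R)).
- by move=> x; rewrite lee_fin powR_ge0.
Qed.

Lemma integral_distribution_dominated (f : borel B -> R) (k : nat) :
  k%:R <= s -> measurable_fun setT f -> (forall x, `|f x| <= N x ^+ k) ->
  P.-integrable setT (EFin \o (fun w => f (X w))) /\
  (\int[mu]_x (f x)%:E = 'E_P[fun w => f (X w)])%E.
Proof.
move=> ks mf fN.
have i : P.-integrable setT (EFin \o (fun w => f (X w))).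
  apply: (@integrable_dominated_power _ _ _ P (fun w => N (X w)) _ s k) => //.
  - exact: measurable_comp_path.
  - by move: moment; rewrite unlock.
  - exact: measurable_comp_path.
split=> //; rewrite unlock integral_distribution//.
exact/measurable_EFinP.
Qed.

Lemma integral_path (t : I01 R) : 1 <= s ->
  P.-integrable setT (EFin \o (fun w => path (X w) t)) /\
  (\int[mu]_x (path x t)%:E = 'E_P[fun w => path (X w) t])%E.
Proof.
by move=> s1; apply: (@integral_distribution_dominated (fun x => path x t) 1).
Qed.

(** The product of the means cancels in the extended reals because both means are finite. *)
Lemma integral_path_mul (t u : I01 R) : 2 <= s ->
  P.-integrable setT (EFin \o (fun w => path (X w) t * path (X w) u)) /\
  (\int[mu]_x (path x t * path x u)%:E =
    covariance P (fun w => path (X w) t) (fun w => path (X w) u) +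
    'E_P[fun w => path (X w) t] * 'E_P[fun w => path (X w) u])%E.
Proof.
move=> s2; have s1 : 1 <= s by rewrite (le_trans _ s2)// ler1n.
have [i e] := @integral_distribution_dominated (fun x => path x t * path x u) 2 s2
  (measurable_funM (path_measurable t) (path_measurable u))
  (fun x => ltac:(by rewrite normrM expr2 ler_pM)).
have /Lfun1_integrable lt := (integral_path t s1).1.
have /Lfun1_integrable lu := (integral_path u s1).1.
split=> //; rewrite e covarianceE//; last exact/Lfun1_integrable.
by rewrite subeK// fin_numM// expectation_fin_num.
Qed.

End random_path.

Theorem same_moments_of_random_paths (s : R)
  (d : measure_display) (Omega : measurableType d) (P : probability Omega R)
  (d' : measure_display) (Omega' : measurableType d') (P' : probability Omega' R)
  (X : {mfun Omega >-> borel B}) (Y : {mfun Omega' >-> borel B}) :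
    let mu : probability (borel B) R := distribution P X in
    let nu : probability (borel B) R := distribution P' Y in
    let moments :=
      ('E_P[(fun w => (supnorm (path (X w)) `^ s)%R)] < +oo)%E /\
      ('E_P'[(fun w => (supnorm (path (Y w)) `^ s)%R)] < +oo)%E in
    let means := forall t : I01 R,
      ('E_P[(fun w => path (X w) t)] = 'E_P'[(fun w => path (Y w) t)])%E in
    let covariances := forall t u : I01 R,
      covariance P (fun w => path (X w) t) (fun w => path (X w) u) =
      covariance P' (fun w => path (Y w) t) (fun w => path (Y w) u) in
    [/\ (0 < s <= 1 -> moments -> same_moments (fun x => supnorm (path x)) s nu mu),
        (1 < s <= 2 -> moments -> means -> same_moments (fun x => supnorm (path x)) s nu mu) &
        (2 < s <= 3 -> moments -> means -> covariances ->
          same_moments (fun x => supnorm (path x)) s nu mu)].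
Proof.
move=> mu nu moments means covariances.
(* One implication covers the three ranges of [s]: up to its threshold, the corresponding premise is
   vacuous. *)
have key : s <= 3 -> moments -> (1 < s -> means) -> (2 < s -> covariances) ->
    same_moments (fun x => supnorm (path x)) s nu mu.
  move=> s3 [mX mY] me co.
  apply: same_moments_of_paths => //; try exact: distribution_finite_moment.
    move=> s1 t; rewrite (integral_path mX t (ltW s1)).2 (integral_path mY t (ltW s1)).2.
    exact: me.
  move=> s2 t u; have s1 : 1 < s by rewrite (lt_trans _ s2)// ltr1n.
  rewrite (integral_path_mul mX t u (ltW s2)).2 (integral_path_mul mY t u (ltW s2)).2.
  by rewrite co// !me.
split.
- by move=> /andP[s0 s1] mo; apply: key => //; lra.
- by move=> /andP[s0 s1] mo me; apply: key => //; lra.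
- by move=> /andP[s0 s1] mo me co; exact: key.
Qed.

End path_space.

(** * Interpolation of cadlag and of continuous paths *)

Section cadlag_interpolation.
Context {R : realType}.
Implicit Types x y : D01 R.

(** The grid must serve a form and its transpose at once, since on the diagonal both arguments are
    interpolated. It contains the right jumps of both at all levels [m.+1%:R^-1]. *)
Lemma D01_grid (g1 g2 : D01 R -> D01 R -> R) (M : R) : 0 <= M ->
  (forall y, scalar (g1 ^~ y)) -> (forall x, scalar (g1 x)) ->
  (forall x y, `|g1 x y| <= M * supnorm x * supnorm y) ->
  (forall y, scalar (g2 ^~ y)) -> (forall x, scalar (g2 x)) ->
  (forall x y, `|g2 x y| <= M * supnorm x * supnorm y) ->
  exists q : nat -> I01 R, (forall n, zero01 \in grid q n) /\ forall x,
    form_null g1 (fun n => step_interp (grid q n) x - x) /\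
    form_null g2 (fun n => step_interp (grid q n) x - x).
Proof.
move=> M0 l1 r1 b1 l2 r2 b2.
pose A m := right_jump g1 m.+1%:R^-1 `|` right_jump g2 m.+1%:R^-1.
have cA : countable (\bigcup_m A m).
  apply: bigcup_countable => // m _.
  have -> : A m = \bigcup_(b in [set: bool]) right_jump (if b then g1 else g2) m.+1%:R^-1.
    apply/seteqP; split => t; first by move=> [ht|ht]; [exists true|exists false].
    by move=> [[] _ ht]; [left|right].
  apply: bigcup_countable => // -[] _.
    by apply: (right_jump_countable l1 r1 M0 b1); rewrite invr_gt0 ltr0n.
  by apply: (right_jump_countable l2 r2 M0 b2); rewrite invr_gt0 ltr0n.
have [q [q0 q1 qd qb]] := exists_grid cA.
exists q; split=> [n|x]; first by rewrite -q0 mem_grid.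
split.
  apply: (form_null_step_interp l1 M0 b1 q0 q1 qd) => m t ht.
  by apply: qb; exists m => //; left.
apply: (form_null_step_interp l2 M0 b2 q0 q1 qd) => m t ht.
by apply: qb; exists m => //; right.
Qed.

Let norm_bound (M : R) x y : M * supnorm x * supnorm y <= `|M| * supnorm x * supnorm y.
Proof. by rewrite !ler_wpM2r ?D01_norm_ge0// ler_norm. Qed.

Lemma D01_bilinear_interp (g : D01 R -> D01 R -> R) (M : R) :
  (forall y, scalar (g ^~ y)) -> (forall x, scalar (g x)) ->
  (forall x y, `|g x y| <= M * supnorm x * supnorm y) ->
  exists s h, interpolates (@cadlag_path R) (fun x => g x x) s h.
Proof.
move=> gl gr gM.
have b1 x y : `|g x y| <= `|M| * supnorm x * supnorm y.
  exact: le_trans (gM x y) (norm_bound _ _ _).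
have b2 x y : `|g y x| <= `|M| * supnorm x * supnorm y by rewrite mulrAC.
have [q [q0 sq]] := D01_grid (normr_ge0 M) gl gr b1 gr gl b2.
exists (grid q), (fun n => cell (grid q n)) => x.
have xn n : supnorm (step_interp (grid q n) x) <= supnorm x.
  by apply: step_interp_norm => //; exact: undup_uniq.
split; first exact: xn.
apply/cvgrPdist_le => e e0; have [s1 s2] := sq x.
have N1 : 0 < supnorm x + 1 by rewrite ltr_wpDl// D01_norm_ge0.
have e'0 : 0 < e / (2 * (supnorm x + 1)) by rewrite divr_gt0// mulr_gt0.
have [n1 h1] := s1 _ e'0; have [n2 h2] := s2 _ e'0.
exists (maxn n1 n2) => // n /=; rewrite geq_max => /andP[nn1 nn2].
rewrite distrC -[X in g X X]/(step_interp (grid q n) x).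
(* The first term is small because the interpolants stay bounded by [supnorm x], the second by
   nullity for the transposed form. *)
have -> : g (step_interp (grid q n) x) (step_interp (grid q n) x) - g x x =
    g (step_interp (grid q n) x - x) (step_interp (grid q n) x) +
    g x (step_interp (grid q n) x - x).
  by rewrite (lformB (gl _)) (lformB (gr _)) addrA subrK.
rewrite (le_trans (ler_normD _ _))//.
have k1 := h1 _ nn1 (step_interp (grid q n) x); have k2 := h2 _ nn2 x.
have e2 : e / (2 * (supnorm x + 1)) * supnorm x <= e / 2.
  have -> : e / 2 = e / (2 * (supnorm x + 1)) * (supnorm x + 1).
    by field; rewrite gt_eqF.
  by rewrite ler_wpM2l ?lerDl// ltW.
have -> : e = e / 2 + e / 2 by lra.
apply: lerD; last exact: le_trans k2 e2.
by rewrite (le_trans k1)// (le_trans _ e2)// ler_wpM2l// ltW.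
Qed.

(** The form [phi] is made bilinear by the factor [y zero01], and recovered by taking for [y] the
    constant path 1, which is [ico 0 2]. *)
Lemma D01_linear_interp (phi : D01 R -> R) (M : R) : scalar phi ->
  (forall x, `|phi x| <= M * supnorm x) ->
  exists s h, interpolates (@cadlag_path R) phi s h.
Proof.
move=> lphi bphi; pose g x y := phi x * y zero01.
have gl y : scalar (g ^~ y) by move=> a u v; rewrite /g lphi mulrDl mulrA.
have gr x : scalar (g x).
  by move=> a u v; rewrite /g (D01_scalar zero01) mulrDr mulrCA.
have b x y : `|g x y| <= `|M| * supnorm x * supnorm y.
  rewrite normrM ler_pM ?D01_norm_ub// (le_trans (bphi x))//.
  by rewrite ler_wpM2r ?D01_norm_ge0// ler_norm.
have [q [q0 sq]] := D01_grid (normr_ge0 M) gl gr b gl gr b.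
exists (grid q), (fun n => cell (grid q n)) => x; split.
  by move=> n; apply: step_interp_norm => //; exact: undup_uniq.
apply/cvgrPdist_le => e e0; have [/(_ _ e0)[n0 h] _] := sq x.
exists n0 => // n /= nn; rewrite distrC -[X in phi X - _]/(step_interp (grid q n) x).
have := h _ nn (ico 0 2).
rewrite /g -[ico 0 2 zero01]/(ico_fun 0 2 zero01) /ico_fun /= lexx ltr0n mulr1.
rewrite (lformB lphi) => /le_trans; apply.
by rewrite ler_piMr ?ico_norm// ltW.
Qed.

End cadlag_interpolation.

(** * Continuous paths: piecewise linear interpolation *)

Section continuous_interpolation.
Context {R : realType}.
Implicit Types x y : C01 R.

Lemma C01_measurable_open (A : set (C01 R)) : open A -> measurable A.
Proof. by move=> oA; apply: sub_sigma_algebra. Qed.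

Lemma C01_norm_ub x t : `|x t| <= supnorm x.
Proof. exact/supnorm_ub/C01_bounded. Qed.

Lemma C01_measurable_lipschitz (f : C01 R -> R) :
  (forall x y, `|f x - f y| <= supnorm (x - y)) -> measurable_fun setT f.
Proof.
move=> lf; apply: measurable_fun_gt => a.
suff : open [set x : C01 R | a < f x] by exact: C01_measurable_open.
rewrite openE => x /= ax; apply/nbhs_ballP.
exists (f x - a) => /=; first by rewrite subr_gt0.
move=> y; rewrite -ball_normE /= => xy.
by have := le_lt_trans (lf x y) xy; rewrite ltr_norml => /andP[_ ?]; lra.
Qed.

Lemma C01_supnorm_measurable : measurable_fun setT (fun x : C01 R => supnorm x).
Proof.
apply: C01_measurable_lipschitz => x y.
exact: (@ler_dist_dist _ (C01 R : normedModType R)).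
Qed.

Lemma C01_eval_measurable (t : I01 R) : measurable_fun setT (fun x : C01 R => x t).
Proof.
by apply: C01_measurable_lipschitz => x y; exact: (C01_norm_ub (x - y) t).
Qed.

Lemma C01_scalar t : scalar (fun x : C01 R => x t).
Proof. by []. Qed.

(** Uniform continuity, from the near-covering form of compactness; two close times are compared
    through the centre of a common neighbourhood. *)
Lemma C01_uniform (x : C01 R) (e : R) : 0 < e -> \forall n \near \oo,
  forall s t : I01 R, `|\val s - \val t| < n.+1%:R^-1 -> `|x s - x t| < e.
Proof.
move=> e0; have K : near_covering `[0 : R, 1]%classic.
  by apply/compact_near_coveringP; exact: segment_compact.
pose P (n : nat) (r : R) := forall s t : I01 R, \val s = r ->
  `|\val s - \val t| < n.+1%:R^-1 -> `|x s - x t| < e.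
have e2 : 0 < e / 2 by rewrite divr_gt0.
have loc (r : R) : `[0 : R, 1]%classic r -> \forall r' \near r & n \near \oo, P n r'.
  move=> r01; pose r0 : I01 R := exist _ r (mem_set r01).
  have /cvgrPdist_lt/(_ _ e2)/nbhs_I01P[d d0 hd] := @C01_continuous _ x r0.
  have d2 : 0 < d / 2 by rewrite divr_gt0.
  have [m md] := invS_lt d2.
  exists (ball r (d / 2), [set n | (m <= n)%N]).
    by split => /=; [by apply: nbhsx_ballx|by exists m].
  move=> [r' n] /= [rr' mn] s t sr' st.
  have rs : `|\val r0 - \val s| < d / 2 by rewrite sr'; exact: rr'.
  have st2 : `|\val s - \val t| < d / 2.
    apply: (lt_trans st); apply: le_lt_trans md.
    by rewrite lef_pV2 ?posrE ?ltr0n// ler_nat ltnS.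
  have h1 : `|x r0 - x s| < e / 2 by apply: hd; lra.
  have h2 : `|x r0 - x t| < e / 2.
    by apply: hd; have := ler_distD (\val s) (\val r0) (\val t); lra.
  have := ler_distD (x r0) (x s) (x t); rewrite (distrC (x s) (x r0)); lra.
have [n0 _ h0] := K nat \oo P _ loc; exists n0 => // n /h0 hn s t.
by apply: (hn (\val s)) => //; exact: set_valP.
Qed.

Definition tent (r i : R) : R := Num.max 0 (1 - `|r - i|).

Lemma tent_ge0 r i : 0 <= tent r i.
Proof. by rewrite /tent le_max lexx. Qed.

Lemma tent_eq0 r i : 1 <= `|r - i| -> tent r i = 0.
Proof. by move=> h; rewrite /tent max_l// subr_le0. Qed.

(** Induction on [m]: the new tent vanishes if [r <= m%:R]; otherwise only the last two tents
    contribute, and their values add up to 1. *)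
Lemma tent_sum m (r : R) : 0 <= r <= m%:R ->
  \sum_(0 <= i < m.+1) tent r i%:R = 1.
Proof.
elim: m => [|m IH] /andP[r0 rm].
  rewrite big_nat1 /tent; have -> : r = 0 by apply/le_anti/andP.
  by rewrite subrr normr0 subr0 max_r.
rewrite big_nat_recr//=; have [rm'|mr] := leP r m%:R.
  rewrite IH ?r0// tent_eq0 ?addr0//.
  by rewrite distrC ger0_norm -natr1; lra.
rewrite big_nat_recr//= big_nat big1 ?add0r => [|i /andP[_ im]].
  move: rm; rewrite -natr1 => rm; rewrite /tent ger0_norm; last by lra.
  by rewrite ler0_norm; [rewrite !max_r; lra|lra].
rewrite tent_eq0//; have : i%:R + 1 <= m%:R :> R by rewrite natr1 ler_nat.
by move=> ?; rewrite ger0_norm; lra.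
Qed.

Lemma tent_lipschitz (r r' i : R) : `|tent r i - tent r' i| <= `|r - r'|.
Proof.
have : `| `|r - i| - `|r' - i| | <= `|r - r'|.
  by rewrite (le_trans (ler_dist_dist _ _))// opprB addrA subrK.
rewrite /tent; move: `|r - i| `|r' - i| `|r - r'| => p p' D.
rewrite !ler_norml => /andP[h1 h2].
by have [hp|hp] := leP 0 (1 - p); have [hp'|hp'] := leP 0 (1 - p');
  apply/andP; split; lra.
Qed.

Lemma tent_continuous (c d : R) : continuous (fun u : I01 R => tent (c * \val u) d).
Proof.
move=> u A /nbhs_ballP[e /= e0 hA]; apply/nbhs_I01P.
have c1 : 0 < `|c| + 1 by rewrite ltr_wpDl.
exists (e / (`|c| + 1)) => [|v uv]; first by rewrite divr_gt0.
apply: hA; rewrite /ball /= (le_lt_trans (tent_lipschitz _ _ _))//.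
rewrite -mulrBr normrM; move: uv; rewrite ltr_pdivlMr// => uv.
by rewrite (le_lt_trans _ uv)// mulrC ler_wpM2l// lerDl.
Qed.

Definition tent_path (c d : R) : C01 R := ContinuousPath (mem_set (@tent_continuous c d)).

Definition nodes n : seq (I01 R) := [seq clamp (i%:R / n.+1%:R) | i <- iota 0 n.+2].

(** Time is multiplied by [n.+1%:R], which sends the nodes to the integers. *)
Definition tents n (g : I01 R) : C01 R := tent_path n.+1%:R (n.+1%:R * \val g).

Lemma tents_ge0 n g t : 0 <= tents n g t.
Proof. exact: tent_ge0. Qed.

Lemma tents_eq0 n g t : n.+1%:R^-1 <= `|\val g - \val t| -> tents n g t = 0.
Proof.
move=> h; apply: tent_eq0; rewrite -mulrBr normrM ger0_norm ?ler0n// distrC.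
by rewrite -ler_pdivrMl ?ltr0n// mulr1.
Qed.

Lemma tents_sum n t : \sum_(g <- nodes n) tents n g t = 1.
Proof.
have nt : 0 <= n.+1%:R * \val t <= n.+1%:R.
  by rewrite mulr_ge0 ?ler0n ?I01_ge0//= ler_piMr ?ler0n ?I01_le1.
apply: etrans (tent_sum nt).
rewrite /nodes big_map /index_iota subn0; apply: eq_big_seq => i.
rewrite mem_iota /= add0n ltnS => im.
rewrite -[LHS]/(tent (n.+1%:R * \val t) (n.+1%:R * \val (clamp (i%:R / n.+1%:R)))).
congr (tent _ _); have n0 : 0 < n.+1%:R :> R by rewrite ltr0n.
have /clampE -> : 0 <= (i%:R / n.+1%:R : R) <= 1.
  by rewrite divr_ge0 ?ler0n//= ler_pdivrMr// mul1r ler_nat.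
by rewrite mulrC divfK// gt_eqF.
Qed.

Lemma interp_tentsE n x t : interp (@continuous_path R) (nodes n) (tents n) x t =
  \sum_(g <- nodes n) x g * tents n g t.
Proof. exact: (lform_sum (C01_scalar t)). Qed.

Lemma interp_tents_norm n x :
  supnorm (interp (@continuous_path R) (nodes n) (tents n) x) <= supnorm x.
Proof.
apply: supnorm_le => t; rewrite interp_tentsE (le_trans (ler_norm_sum _ _ _))//.
have -> : supnorm x = \sum_(g <- nodes n) supnorm x * tents n g t.
  by rewrite -mulr_sumr tents_sum mulr1.
apply: ler_sum => g _; rewrite normrM (ger0_norm (tents_ge0 _ _ _)) ler_wpM2r ?tents_ge0//.
exact: C01_norm_ub.
Qed.

(** The tents form a partition of unity, and only those at nodes within [n.+1%:R^-1] of [t]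
    contribute at [t]. *)
Lemma interp_tents_cvg x (e : R) : 0 < e -> \forall n \near \oo,
  supnorm (interp (@continuous_path R) (nodes n) (tents n) x - x) <= e.
Proof.
move=> e0; apply: filterS (C01_uniform x e0) => n hn.
apply: supnorm_le => t; rewrite (lformB (C01_scalar t)) interp_tentsE.
have split_sum (c : R) : c = \sum_(g <- nodes n) c * tents n g t.
  by rewrite -mulr_sumr tents_sum mulr1.
rewrite [x t]split_sum -sumrB (le_trans (ler_norm_sum _ _ _))// [leRHS]split_sum.
apply: ler_sum => g _; rewrite -mulrBl normrM (ger0_norm (tents_ge0 _ _ _)).
have [h|h] := ltP `|\val g - \val t| n.+1%:R^-1.
  by rewrite ler_wpM2r ?tents_ge0// ltW// hn.
by rewrite tents_eq0// !mulr0.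
Qed.

Let N0 x : 0 <= supnorm x.
Proof. exact/supnorm_ge0/C01_bounded. Qed.

Lemma C01_bilinear_interp (g : C01 R -> C01 R -> R) (M : R) :
  (forall y, scalar (g ^~ y)) -> (forall x, scalar (g x)) ->
  (forall x y, `|g x y| <= M * supnorm x * supnorm y) ->
  exists s h, interpolates (@continuous_path R) (fun x => g x x) s h.
Proof.
move=> gl gr gM; exists nodes, tents => x; split=> [n|]; first exact: interp_tents_norm.
have gM' u v : `|g u v| <= `|M| * supnorm u * supnorm v.
  by rewrite (le_trans (gM u v))// !ler_wpM2r// ler_norm.
apply/cvgrPdist_le => e e0.
have c0 : 0 < 2 * (`|M| * supnorm x + 1).
  by rewrite mulr_gt0// ltr_wpDl// mulr_ge0.
have e'0 : 0 < e / (2 * (`|M| * supnorm x + 1)) by rewrite divr_gt0.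
have [n0 _ h0] := interp_tents_cvg x e'0; exists n0 => // n /h0.
have := interp_tents_norm n x.
set z := interp _ _ _ _ => zx zn; rewrite distrC.
have -> : g z z - g x x = g (z - x) z + g x (z - x).
  by rewrite (lformB (gl _)) (lformB (gr _)) addrA subrK.
have b : `|M| * supnorm x * supnorm (z - x) <= e / 2.
  apply: (le_trans (ler_wpM2l _ zn)); first by rewrite mulr_ge0.
  have -> : e / 2 = (`|M| * supnorm x + 1) * (e / (2 * (`|M| * supnorm x + 1))).
    by field; rewrite gt_eqF// ltr_wpDl// mulr_ge0.
  by rewrite (ler_wpM2r (ltW e'0))// lerDl.
rewrite (le_trans (ler_normD _ _))//.
have -> : e = e / 2 + e / 2 by lra.
apply: lerD; last exact: le_trans (gM' _ _) b.
rewrite (le_trans (gM' _ _))// (le_trans _ b)// mulrAC ler_wpM2r//.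
by rewrite ler_wpM2l.
Qed.

Lemma C01_linear_interp (phi : C01 R -> R) (M : R) : scalar phi ->
  (forall x, `|phi x| <= M * supnorm x) ->
  exists s h, interpolates (@continuous_path R) phi s h.
Proof.
move=> lphi bphi; exists nodes, tents => x; split=> [n|]; first exact: interp_tents_norm.
apply/cvgrPdist_le => e e0.
have M1 : 0 < `|M| + 1 by rewrite ltr_wpDl.
have e'0 : 0 < e / (`|M| + 1) by rewrite divr_gt0.
have [n0 _ h0] := interp_tents_cvg x e'0; exists n0 => // n /h0.
rewrite ler_pdivlMr// => zn; rewrite distrC -(lformB lphi).
rewrite (le_trans (bphi _))// (le_trans _ zn)// mulrC ler_wpM2l//.
by rewrite (le_trans (ler_norm M))// lerDl.
Qed.

End continuous_interpolation.

Theorem lemma23 (R : realType) (s : R)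
  (d : measure_display) (Omega : measurableType d) (P : probability Omega R)
  (d' : measure_display) (Omega' : measurableType d') (P' : probability Omega' R) :
  (forall (X : {mfun Omega >-> C01 R}) (Y : {mfun Omega' >-> C01 R}),
    let mu : probability (C01 R) R := distribution P X in
    let nu : probability (C01 R) R := distribution P' Y in
    let moments :=
      ('E_P[(fun w => (supnorm (X w) `^ s)%R)] < +oo)%E /\
      ('E_P'[(fun w => (supnorm (Y w) `^ s)%R)] < +oo)%E in
    let means := forall t : I01 R,
      ('E_P[(fun w => X w t)] = 'E_P'[(fun w => Y w t)])%E in
    let covariances := forall t u : I01 R,
      covariance P (fun w => X w t) (fun w => X w u) =
      covariance P' (fun w => Y w t) (fun w => Y w u) in
    [/\ (0 < s <= 1 -> moments -> same_moments (fun x : C01 R => supnorm x) s nu mu),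
        (1 < s <= 2 -> moments -> means -> same_moments (fun x : C01 R => supnorm x) s nu mu) &
        (2 < s <= 3 -> moments -> means -> covariances ->
          same_moments (fun x : C01 R => supnorm x) s nu mu)]) /\
  (forall (X : {mfun Omega >-> D01 R}) (Y : {mfun Omega' >-> D01 R}),
    let mu : probability (D01 R) R := distribution P X in
    let nu : probability (D01 R) R := distribution P' Y in
    let moments :=
      ('E_P[(fun w => (supnorm (X w) `^ s)%R)] < +oo)%E /\
      ('E_P'[(fun w => (supnorm (Y w) `^ s)%R)] < +oo)%E in
    let means := forall t : I01 R,
      ('E_P[(fun w => X w t)] = 'E_P'[(fun w => Y w t)])%E in
    let covariances := forall t u : I01 R,
      covariance P (fun w => X w t) (fun w => X w u) =
      covariance P' (fun w => Y w t) (fun w => Y w u) in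
    [/\ (0 < s <= 1 -> moments -> same_moments (fun x : D01 R => supnorm x) s nu mu),
        (1 < s <= 2 -> moments -> means -> same_moments (fun x : D01 R => supnorm x) s nu mu) &
        (2 < s <= 3 -> moments -> means -> covariances ->
          same_moments (fun x : D01 R => supnorm x) s nu mu)]).
Proof.
split=> X Y.
  (* The sigma-algebra of each path space is by definition that of its [borel] copy, so the general
     theorem applies as it stands. *)
  exact: (@same_moments_of_random_paths R (C01 R) (@continuous_path R)
    (@C01_bounded R) C01_eval_measurable C01_supnorm_measurable
    (@C01_linear_interp R) (@C01_bilinear_interp R) s d Omega P d' Omega' P' X Y).
exact: (@same_moments_of_random_paths R (D01 R) (@cadlag_path R)
    (@D01_bounded R) D01_eval_measurable D01_supnorm_measurable
    (@D01_linear_interp R) (@D01_bilinear_interp R) s d Omega P d' Omega' P' X Y).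
Qed.
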